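(* Let $k$ be an arbitrary field, let $\mathfrak A$ be a standard graded Artinian Gorenstein $k$-algebra of embedding dimension four and socle degree three, and let $\pi:P\to\mathfrak A$ be a surjective graded $k$-algebra homomorphism from a (standard graded) polynomial ring $P$ with four variables over $k$ onto $\mathfrak A$. Then the defining ideal $\ker\pi$ of $\mathfrak A$ has $6$, $7$, or $9$ minimal generators.
   Context: A graded $k$-algebra $\mathfrak A=\bigoplus_{i\ge 0}\mathfrak A_i$ with $\mathfrak A_0=k$ is standard graded if $\mathfrak A_1$ is finite dimensional and generates $\mathfrak A$ as a $k$-algebra; its embedding dimension is $\dim_k\mathfrak A_1$. An Artinian standard graded $k$-algebra $\mathfrak A=\bigoplus_{i=0}^{\sigma}\mathfrak A_i$ is Gorenstein with socle degree $\sigma$ if $\dim_k\mathfrak A_\sigma=1$ and every nonzero ideal of $\mathfrak A$ contains $\mathfrak A_\sigma$. *)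

(* Defs.v *)
From HB Require Import structures.
From mathcomp Require Import all_boot all_order all_algebra.
From mathcomp Require Import mpoly.

Set Implicit Arguments.
Unset Strict Implicit.
Unset Printing Implicit Defensive.

Import GRing.Theory.
Local Open Scope ring_scope.

Record is_ideal (R : comNzRingType) (I : R -> Prop) : Prop := IsIdeal {
  ideal0 : I 0;
  idealD : forall x y, I x -> I y -> I (x + y);
  idealM : forall a x, I x -> I (a * x)
}.

Definition artinian (R : comNzRingType) : Prop :=
  forall I : nat -> R -> Prop,
    (forall n, is_ideal (I n)) ->
    (forall n x, I n.+1 x -> I n x) ->
    exists n, forall m x, (n <= m)%N -> I n x -> I m x.

Record is_subspace (k : fieldType) (V : lmodType k) (W : V -> Prop) : Prop :=
  IsSubspace {
  subspace0 : W 0;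
  subspaceD : forall x y, W x -> W y -> W (x + y);
  subspaceZ : forall (c : k) x, W x -> W (c *: x)
}.

Definition has_dim (k : fieldType) (V : lmodType k) (W : V -> Prop) (n : nat)
    : Prop :=
  exists b : 'I_n -> V,
    (forall i, W (b i)) /\
    (forall v, W v -> exists! c : 'rV[k]_n, v = \sum_(i < n) c 0 i *: b i).

Record is_subalgebra (k : fieldType) (A : comAlgType k) (B : A -> Prop) : Prop :=
  IsSubalgebra {
  subalg_subspace : is_subspace B;
  subalg1 : B 1;
  subalgM : forall x y, B x -> B y -> B (x * y)
}.

Record is_grading (k : fieldType) (A : comAlgType k) (Agr : nat -> A -> Prop)
    : Prop := IsGrading {
  grading_subspace : forall i, is_subspace (Agr i);
  grading_sum : forall a, exists n (f : nat -> A),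
    (forall i, Agr i (f i)) /\ a = \sum_(i < n) f i;
  grading_direct : forall n (f : nat -> A), (forall i, Agr i (f i)) ->
    \sum_(i < n) f i = 0 -> forall i, (i < n)%N -> f i = 0;
  gradingM : forall i j x y, Agr i x -> Agr j y -> Agr (i + j)%N (x * y);
  grading0 : forall a, Agr 0%N a <-> exists c : k, a = c%:A
}.

Record standard_graded (k : fieldType) (A : comAlgType k)
    (Agr : nat -> A -> Prop) : Prop := StandardGraded {
  standard_grading : is_grading Agr;
  standard_findim : exists n, has_dim (Agr 1%N) n;
  standard_generated : forall B : A -> Prop, is_subalgebra B ->
    (forall a, Agr 1%N a -> B a) -> forall a, B a
}.

(* The ideals in [gorenstein_socle] are arbitrary, not only homogeneous. *)
Record artinian_gorenstein (k : fieldType) (A : comAlgType k)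
    (Agr : nat -> A -> Prop) (sigma : nat) : Prop := ArtinianGorenstein {
  gorenstein_standard : standard_graded Agr;
  gorenstein_artinian : artinian A;
  gorenstein_top : forall i a, (sigma < i)%N -> Agr i a -> a = 0;
  gorenstein_dim : has_dim (Agr sigma) 1;
  gorenstein_socle : forall I : A -> Prop, is_ideal I ->
    (exists x, I x /\ x <> 0) -> forall a, Agr sigma a -> I a
}.

Definition generates (R : comNzRingType) (I : R -> Prop) (m : nat)
    (b : 'I_m -> R) (S : {set 'I_m}) : Prop :=
  forall p, I p <-> exists c : 'I_m -> R, p = \sum_(i in S) c i * b i.

(* Homogeneity of the generators is needed: irredundant systems of
   inhomogeneous generators may have different sizes. *)
Definition minimal_generators (k : fieldType) (n : nat)
    (I : {mpoly k[n]} -> Prop) (m : nat) (b : 'I_m -> {mpoly k[n]}) : Prop :=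
  [/\ forall i, exists d, b i \is d.-homog,
      generates I b [set: 'I_m]
    & forall S : {set 'I_m}, S \proper [set: 'I_m] -> ~ generates I b S].

Definition num_minimal_generators (k : fieldType) (n : nat)
    (I : {mpoly k[n]} -> Prop) (m : nat) : Prop :=
  (exists b : 'I_m -> {mpoly k[n]}, minimal_generators I b) /\
  (forall m' (b : 'I_m' -> {mpoly k[n]}), minimal_generators I b -> m' = m).

(* Main.v *)
Require Import Defs.
From HB Require Import structures.
From mathcomp Require Import all_boot all_order all_algebra.
From mathcomp Require Import mpoly ring zify.
From Stdlib Require Import Classical.

Set Implicit Arguments.
Unset Strict Implicit.
Unset Printing Implicit Defensive.

Import GRing.Theory.
Local Open Scope ring_scope.

(** The multiplication [A_1 x A_1 x A_1 -> A_3 = k] is a nondegenerate symmetric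
    trilinear form [phi] on [V = A_1].  Let [S] be the commutative algebra of the
    endomorphisms [s] of [V] with [phi (s x) y z = phi x (s y) z].  The kernel
    contains six quadrics, and its cubics modulo multiples of these quadrics are
    dual to [S / k], so there are [6 + (dim S - 1)] minimal generators and it
    remains to see that [dim S] is 1, 2 or 4.

    If the bilinear form [phi l] is nondegenerate for some [l], then
    [phi l (x * y) z = phi x y z] makes [V] a commutative, possibly
    nonassociative, algebra with unit [l] whose nucleus is [S].  When [S] has
    codimension one, the associator factors through a one-dimensional space,
    where it vanishes by commutativity, so that [S] is everything: hence
    [dim S <= 4] and [dim S <> 3].

    Such an [l] exists as soon as [dim S >= 3].  Indeed [s(V)] and [ker s]
    annihilate each other under [phi] for [s] in [S]; playing this against the
    orbits [S u] either exhibits [l] or produces [y] such that [phi y] has rank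
    one and [phi y y = 0], and then [l] is found in a family of binary quadratic
    forms. *)

(** * Binary forms *)

Section BinaryForms.

Variables (k : fieldType) (al be ga A B C D : k).

(** A common radical vector of the Gram matrices of three binary forms; the last two matrices share
    the row [(B, C)], whence five equations instead of six. *)
Definition common_kernel := exists x y : k, (x, y) != (0, 0) /\
  [/\ x * al + y * be = 0, x * be + y * ga = 0, x * A + y * B = 0,
      x * B + y * C = 0 & x * C + y * D = 0].

(* The binary forms [al, be, ga] + a [A, B, C] + b [B, C, D], given by their
   Gram matrices, all have zero determinant. *)
Hypothesis degenerate : forall a b : k,
  (al + a * A + b * B) * (ga + a * C + b * D) = (be + a * B + b * C) ^+ 2.

(* Over [F_2] the values at the four pairs [(a, b)] do not determine the
   coefficients of a quadratic polynomial, whence a finite check. *)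
Lemma common_kernel_F2 : (forall x : k, x = 0 \/ x = 1) -> common_kernel.
Proof.
move=> F2; have two0 : 1 + 1 = 0 :> k.
  case: (F2 (1 + 1)) => // /eqP; rewrite -subr_eq0 addrK => /eqP/eqP.
  by rewrite oner_eq0.
have H00 := degenerate 0 0; have H10 := degenerate 1 0.
have H01 := degenerate 0 1; have H11 := degenerate 1 1.
have n10 : (1 : k) <> 0 by apply/eqP; rewrite oner_eq0.
have n01 : (0 : k) <> 1 by move/esym.
pose simp := (expr2, mul0r, mulr0, mul1r, mulr1, add0r, addr0, two0).
clear degenerate; rewrite /common_kernel.
case: (F2 al) H00 H10 H01 H11 => ->; case: (F2 be) => ->; case: (F2 ga) => ->;
case: (F2 A) => ->; case: (F2 B) => ->; case: (F2 C) => ->;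
case: (F2 D) => ->; rewrite !simp => H00 H10 H01 H11;
try (by []);
solve [ by exists 1, 0; split;
        [rewrite xpair_eqE negb_and oner_eq0 | split; rewrite !simp]
      | by exists 0, 1; split;
        [rewrite xpair_eqE negb_and oner_eq0 orbT | split; rewrite !simp]
      | by exists 1, 1; split;
        [rewrite xpair_eqE negb_and oner_eq0 | split; rewrite !simp] ].
Qed.

Lemma quadratic_eq0 (t a0 a1 a2 : k) : t != 0 -> t != 1 ->
  a0 = 0 -> a0 + a1 + a2 = 0 -> a0 + a1 * t + a2 * t ^+ 2 = 0 ->
  a1 = 0 /\ a2 = 0.
Proof.
move=> t0 t1 -> e1 e2.
have a10 : t * (t - 1) * a2 = 0.
  transitivity ((0 + a1 * t + a2 * t ^+ 2) - t * (0 + a1 + a2)); first by ring.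
  by rewrite e1 e2 mulr0 subr0.
have a20 : a2 = 0.
  apply/eqP; move/eqP: a10; rewrite !mulf_eq0 (negPf t0) subr_eq0.
  by rewrite (negPf t1).
by move: e1; rewrite a20 addr0 add0r.
Qed.

Lemma sqr_eq0_sub (x y z : k) : (x - y) ^+ 2 = z -> z = 0 -> x = y.
Proof. by move=> <- /eqP; rewrite sqrf_eq0 subr_eq0 => /eqP. Qed.

(** Over a field with a third element [t], the determinant vanishes as a polynomial in [a] and [b].
    Its coefficients force all 2 x 2 minors of the five stacked Gram rows to vanish, so these rows
    have rank at most one. *)
Lemma degenerate_common_kernel : common_kernel.
Proof.
case: (classic (exists t : k, t != 0 /\ t != 1)) => [[t [t0 t1]]|noT]; last first.
  apply: common_kernel_F2 => x; have [->|x0] := eqVneq x 0; first by left.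
  have [->|x1] := eqVneq x 1; first by right.
  by case: noT; exists x.
have dec a b : (al * ga - be ^+ 2)
   + (al * C + ga * A - (1 + 1) * (be * B)) * a
   + (al * D + ga * B - (1 + 1) * (be * C)) * b
   + (A * C - B ^+ 2) * a ^+ 2 + (A * D - B * C) * (a * b)
   + (B * D - C ^+ 2) * b ^+ 2 = 0.
  by transitivity ((al + a * A + b * B) * (ga + a * C + b * D)
      - (be + a * B + b * C) ^+ 2); [ring | rewrite degenerate subrr].
have e0 : al * ga - be ^+ 2 = 0 by rewrite -[RHS](dec 0 0); ring.
have [ea eaa] : al * C + ga * A - (1 + 1) * (be * B) = 0 /\ A * C - B ^+ 2 = 0.
  apply: (quadratic_eq0 t0 t1 e0).
    by rewrite -[RHS](dec 1 0); ring.
  by rewrite -[RHS](dec t 0); ring.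
have [eb ebb] : al * D + ga * B - (1 + 1) * (be * C) = 0 /\ B * D - C ^+ 2 = 0.
  apply: (quadratic_eq0 t0 t1 e0).
    by rewrite -[RHS](dec 0 1); ring.
  by rewrite -[RHS](dec 0 t); ring.
have eab : A * D = B * C.
  apply/eqP; rewrite -subr_eq0; apply/eqP; rewrite -[RHS](dec 1 1) e0 ea eb eaa ebb.
  by ring.
move: e0 ea eaa eb ebb => /subr0_eq e0 /subr0_eq ea /subr0_eq eaa.
move=> /subr0_eq eb /subr0_eq ebb.
(* The 2 x 2 minors of the matrix with rows (al, be), (be, ga), (A, B), (B, C),
   (C, D) that are not already coefficients have square zero. *)
have m13 : al * B = be * A.
  apply: (@sqr_eq0_sub _ _ (al ^+ 2 * (B ^+ 2 - A * C)
    + al * A * (al * C + ga * A - (1 + 1) * (be * B)) - A ^+ 2 * (al * ga - be ^+ 2))).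
    by ring.
  by rewrite eaa ea e0; ring.
have m14 : al * C = be * B.
  apply: (@sqr_eq0_sub _ _ (al * C * (al * C + ga * A - (1 + 1) * (be * B))
     + be ^+ 2 * (B ^+ 2 - A * C) - A * C * (al * ga - be ^+ 2))).
    by ring.
  by rewrite eaa ea e0; ring.
have m15 : al * D = be * C.
  apply: (@sqr_eq0_sub _ _ (al * D * (al * D + ga * B - (1 + 1) * (be * C))
     + be ^+ 2 * (C ^+ 2 - B * D) - B * D * (al * ga - be ^+ 2))).
    by ring.
  by rewrite ebb eb e0; ring.
have m23 : be * B = ga * A.
  by apply: (addrI (al * C)); rewrite ea m14; ring.
have m25 : be * D = ga * C.
  apply: (@sqr_eq0_sub _ _ (D ^+ 2 * (be ^+ 2 - al * ga) + ga ^+ 2 * (C ^+ 2 - B * D)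
     + ga * D * (al * D + ga * B - (1 + 1) * (be * C)))).
    by ring.
  by rewrite ebb eb e0; ring.
have m24 : be * C = ga * B.
  by apply: (addrI (al * D)); rewrite eb m15; ring.
(* Once every row is proportional to a nonzero row [(x, y)], the vector [(y, - x)] is orthogonal to
   all of them. *)
have row x y : (x, y) != (0, 0) ->
    [/\ y * al = x * be, y * be = x * ga, y * A = x * B, y * B = x * C & y * C = x * D] ->
    common_kernel.
  move=> xy [h1 h2 h3 h4 h5]; exists y, (- x); split.
    by move: xy; rewrite !xpair_eqE oppr_eq0 andbC.
  by rewrite h1 h2 h3 h4 h5; split; ring.
have [[al0 be0]|/row] := eqVneq (al, be) (0, 0); last first.
  by apply; split; rewrite ?[be * _]mulrC // -?[RHS]expr2 ?e0 ?m13 ?m14 ?m15 //; ring.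
have [[_ ga0]|/row] := eqVneq (be, ga) (0, 0); last first.
  apply; split; [by rewrite -[RHS]expr2 -e0 mulrC | by rewrite mulrC | done..].
have [[A0 B0]|/row] := eqVneq (A, B) (0, 0); last first.
  apply; rewrite al0 be0 ga0 !mulr0.
  by split; rewrite // -?[RHS]expr2 -?eaa -?eab mulrC.
have [[_ C0]|/row] := eqVneq (B, C) (0, 0); last first.
  apply; rewrite al0 be0 ga0 A0 B0 !mulr0.
  by split; rewrite // ?mul0r // -expr2 -ebb B0 mul0r.
have [[_ D0]|/row cd] := eqVneq (C, D) (0, 0).
  exists 1, 0; rewrite xpair_eqE negb_and oner_eq0; split=> //.
  by rewrite al0 be0 ga0 A0 B0 C0 D0; split; ring.
by apply: cd; rewrite al0 be0 ga0 A0 B0 C0 !mulr0; split; rewrite // mul0r.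
Qed.

End BinaryForms.

(** * Symmetric trilinear forms in dimension four *)

Lemma dim2_basis (k : fieldType) (V : vectType k) (U : {vspace V}) :
  \dim U = 2%N -> exists p q, [/\ p \in U, q \in U,
    forall x, x \in U -> exists a b, x = a *: p + b *: q
  & forall a b, a *: p + b *: q = 0 -> a = 0 /\ b = 0].
Proof.
move=> dU; have := vbasisP U; move: (vbasis U); rewrite dU => X bX.
have pq x : \sum_(i < 2) x i *: X`_i = x 0 *: X`_0 + x 1 *: X`_1.
  by rewrite big_ord_recl big_ord1 (_ : lift ord0 ord0 = 1 :> 'I_2) //; apply: val_inj.
exists X`_0, X`_1; split.
- by rewrite (basis_mem bX) // mem_nth // size_tuple.
- by rewrite (basis_mem bX) // mem_nth // size_tuple.
- by move=> x /(coord_basis bX) ->; rewrite pq; eexists; eexists.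
move=> a b ab0; have /freeP fX := basis_free bX.
have := fX (fun i => if i == 0 then a else b); rewrite pq /= => /(_ ab0) c0.
by split; [apply: (c0 0) | apply: (c0 1)].
Qed.

Lemma det2_eq0 (k : fieldType) (x y a b c : k) :
  (x, y) != (0, 0) -> x * a + y * b = 0 -> x * b + y * c = 0 -> a * c = b ^+ 2.
Proof.
move=> xy h1 h2; apply/eqP; rewrite -subr_eq0; apply/eqP.
have hx : x * (a * c - b ^+ 2) = 0.
  transitivity (c * (x * a + y * b) - b * (x * b + y * c)); first by ring.
  by rewrite h1 h2; ring.
have hy : y * (a * c - b ^+ 2) = 0.
  transitivity (a * (x * b + y * c) - b * (x * a + y * b)); first by ring.
  by rewrite h1 h2; ring.
apply/eqP; apply: contraNT xy => d; rewrite xpair_eqE.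
by move/eqP: hx; move/eqP: hy; rewrite !mulf_eq0 (negPf d) !orbF => -> ->.
Qed.

Section TrilinearForm.

Variables (k : fieldType) (V : vectType k) (phi : V -> V -> V -> k).
Hypothesis phi_linear : forall a x x' y z,
  phi (a *: x + x') y z = a * phi x y z + phi x' y z.
Hypothesis phiC12 : forall x y z, phi x y z = phi y x z.
Hypothesis phiC23 : forall x y z, phi x y z = phi x z y.
Hypothesis phi_nondeg : forall x, (forall y z, phi x y z = 0) -> x = 0.

Lemma phi_linear2 a x y y' z :
  phi x (a *: y + y') z = a * phi x y z + phi x y' z.
Proof. by rewrite !(phiC12 x) phi_linear. Qed.

Lemma phiD1 x x' y z : phi (x + x') y z = phi x y z + phi x' y z.
Proof. by rewrite -[x]scale1r phi_linear scale1r mul1r. Qed.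

Lemma phi01 y z : phi 0 y z = 0.
Proof. by apply: (addrI (phi 0 y z)); rewrite -phiD1 !addr0. Qed.

Lemma phiZ1 a x y z : phi (a *: x) y z = a * phi x y z.
Proof. by rewrite -[a *: x]addr0 phi_linear phi01 addr0. Qed.

Lemma phiD2 x y y' z : phi x (y + y') z = phi x y z + phi x y' z.
Proof. by rewrite !(phiC12 x) phiD1. Qed.

Lemma phiZ2 a x y z : phi x (a *: y) z = a * phi x y z.
Proof. by rewrite !(phiC12 x) phiZ1. Qed.

Lemma phi02 x z : phi x 0 z = 0.
Proof. by rewrite phiC12 phi01. Qed.

Lemma phiD3 x y z z' : phi x y (z + z') = phi x y z + phi x y z'.
Proof. by rewrite !(phiC23 x y) phiD2. Qed.

Lemma phiZ3 a x y z : phi x y (a *: z) = a * phi x y z.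
Proof. by rewrite !(phiC23 x y) phiZ2. Qed.

Lemma phi03 x y : phi x y 0 = 0.
Proof. by rewrite phiC23 phi02. Qed.

Lemma phi_sum3 x y I (r : seq I) (P : pred I) (F : I -> V) :
  phi x y (\sum_(i <- r | P i) F i) = \sum_(i <- r | P i) phi x y (F i).
Proof. exact: (big_morph (phi x y) (phiD3 x y) (phi03 x y)). Qed.

Let e := vbasis {:V}.

(** Row vectors stand for the dual of [V], so that [slice l] is the map from [V] to its dual given
    by the bilinear form [phi l]. *)
Definition slice_row l x : 'rV[k]_(\dim {:V}) := \row_j phi l x e`_j.

Lemma slice_row_is_linear l : linear (slice_row l).
Proof. by move=> a x y; apply/rowP => j; rewrite !mxE phi_linear2. Qed.

HB.instance Definition _ l :=
  GRing.isLinear.Build k V 'rV[k]_(\dim {:V}) _ (slice_row l)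
    (slice_row_is_linear l).

Definition slice l : 'Hom(V, 'rV[k]_(\dim {:V})) := linfun (slice_row l).

Lemma slice_eq l x l' x' : slice l x = slice l' x' ->
  forall z, phi l x z = phi l' x' z.
Proof.
rewrite !lfunE => /rowP eq_e z; rewrite (coord_vbasis (memvf z)) !phi_sum3.
by apply: eq_bigr => i _; have := eq_e i; rewrite !mxE !phiZ3 => ->.
Qed.

(** The radical of [phi x]; in the Gorenstein algebra, the elements of degree one whose product with
    [x] is zero. *)
Definition ann x : {vspace V} := lker (slice x).

Lemma annP x y : reflect (forall z, phi x y z = 0) (y \in ann x).
Proof.
rewrite memv_ker; apply: (iffP eqP) => [h z|h].
  by rewrite (@slice_eq x y x 0) ?phi02 // h linear0.
by rewrite lfunE; apply/rowP => j; rewrite !mxE h.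
Qed.

Lemma annC x y : (y \in ann x) = (x \in ann y).
Proof. by apply/annP/annP => h z; rewrite phiC12 h. Qed.

Lemma ann_full x : ann x = fullv -> x = 0.
Proof. by move=> xV; apply: phi_nondeg => y; apply/annP; rewrite xV memvf. Qed.

(** * Self-adjoint endomorphisms and their orbits *)

Definition selfadj (s : 'End(V)) := forall x y z, phi (s x) y z = phi x (s y) z.

Lemma selfadjP s x y z : selfadj s -> phi (s x) y z = phi x y (s z).
Proof. by move=> hs; rewrite phiC23 hs phiC23. Qed.

Lemma selfadj23 s x y z : selfadj s -> phi x (s y) z = phi x y (s z).
Proof. by move=> hs; rewrite -hs (selfadjP _ _ _ hs). Qed.

(** Move [s] to the second argument of [phi] and [t] to the third: the order of composition no
    longer shows. *)
Lemma selfadj_comm s t x : selfadj s -> selfadj t -> s (t x) = t (s x).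
Proof.
move=> hs ht; apply: subr0_eq; apply: phi_nondeg => y z.
rewrite -scaleN1r addrC phi_linear.
by rewrite hs !(selfadjP _ _ _ ht) hs; ring.
Qed.

Definition eval_at u (s : 'End(V)) : V := s u.

Lemma eval_at_is_linear u : linear (eval_at u).
Proof. by move=> a s t; rewrite /eval_at add_lfunE scale_lfunE. Qed.

HB.instance Definition _ u :=
  GRing.isLinear.Build k 'End(V) V _ (eval_at u) (eval_at_is_linear u).

Definition ev u : 'Hom('End(V), V) := linfun (eval_at u).

Lemma evE u s : ev u s = s u.
Proof. by rewrite lfunE. Qed.

Lemma slice_limg l : ann l = 0%VS -> limg (slice l) = fullv.
Proof.
move=> l0; apply/eqP; rewrite eqEdim subvf /=.
have := limg_ker_dim (slice l) fullv; rewrite capfv -/(ann l) l0 dimv0 add0n.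
by move=> ->; rewrite dimvf /= dim_matrix mul1r.
Qed.

Variable S : {vspace 'End(V)}.
Hypothesis memS : forall s, s \in S <-> selfadj s.

Lemma mem_orbit s u : s \in S -> s u \in (ev u @: S)%VS.
Proof. by move=> sS; rewrite -evE memv_img. Qed.

Lemma selfadj_id : \1%VF \in S.
Proof. by apply/memS => x y z; rewrite !id_lfunE. Qed.

Lemma mem_orbit_id u : u \in (ev u @: S)%VS.
Proof. by rewrite -{1}[u]id_lfunE mem_orbit ?selfadj_id. Qed.

(** A self-adjoint [s] moves from [u] to the third argument, where [phi u y] vanishes anyway. *)
Lemma orbit_ann u y : y \in ann u -> (ev u @: S <= ann y)%VS.
Proof.
move=> /annP yu; apply/subvP => _ /memv_imgP[s sS ->]; apply/annP => z.
have hs := proj1 (memS s) sS.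
by rewrite evE phiC12 (selfadjP _ _ _ hs) yu.
Qed.

(** Evaluation at [l] is injective on [S]: if [s l = 0], then [phi l (s x) z = phi (s l) x z = 0],
    so [s x] lies in [ann l]. *)
Lemma lefschetz_orbit_dim l : ann l = 0%VS -> \dim (ev l @: S) = \dim S.
Proof.
move=> l0; apply: limg_dim_eq; apply/eqP; rewrite -subv0; apply/subvP => s.
rewrite memv_cap memv_ker evE memv0 => /andP[/memS hs /eqP sl0].
apply/eqP/lfunP => x; rewrite zero_lfunE; apply/eqP; rewrite -memv0 -l0.
by apply/annP => z; rewrite -hs sl0 phi01.
Qed.

(* Multiplication by [w] relative to [l] is self-adjoint: its defect is
   alternating and vanishes on the orbit of [l], a hyperplane. *)
Lemma lefschetz_dim_neq l : ann l = 0%VS -> (\dim S).+1 != \dim {:V}.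
Proof.
move=> l0; apply/negP => /eqP dimS.
have dimO := lefschetz_orbit_dim l0; set O := (ev l @: S)%VS in dimO.
have [w _ wO] : exists2 w, w \in fullv & w \notin O.
  by apply/subvPn; apply/negP => /dimvS; rewrite -dimS dimO ltnn.
have Ow : (O + <[w]>)%VS = fullv.
  apply/eqP; rewrite eqEdim subvf -dimS /= ltn_neqAle -dimO dimvS ?addvSl // andbT.
  apply: contra wO; rewrite (dimv_leqif_eq (addvSl _ _)) => /eqP ->.
  by apply: (subvP (addvSr _ _)); apply: memv_line.
pose T : 'End(V) := ((slice l)^-1 \o slice w)%VF.
have hT x z : phi l (T x) z = phi w x z.
  by apply: slice_eq; rewrite comp_lfunE limg_lfunVK // slice_limg ?memvf.
have Teq x x' : (forall z, phi l x z = phi l x' z) -> x = x'.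
  move=> h; apply/eqP; rewrite -subr_eq0 -memv0 -l0; apply/annP => z.
  by rewrite -scaleN1r addrC phi_linear2 h; ring.
have Ts s x : selfadj s -> T (s x) = s (T x).
  by move=> hs; apply: Teq => z; rewrite hT !(selfadj23 _ _ _ hs) hT.
have Tl : T l = w by apply: Teq => z; rewrite hT phiC12.
have TO s y z : selfadj s -> phi (T (s l)) y z = phi (s l) (T y) z.
  move=> hs; rewrite Ts // Tl !(selfadjP _ _ _ hs) hT.
  by [].
suff TS : T \in S by case/negP: wO; rewrite -Tl mem_orbit.
have dec x : exists s a, selfadj s /\ x = s l + a *: w.
  have /memv_addP[_ /memv_imgP[s sS ->] [_ /vlineP[a ->] ->]] :
    x \in (O + <[w]>)%VS by rewrite Ow memvf.
  by exists s, a; rewrite evE; split=> //; apply/memS.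
apply/memS => x y z.
(* After bilinear expansion, [TO] settles the terms with an argument in the orbit, and the remaining
   term in [w] and [w] is symmetric. *)
have [s [a [hs ->]]] := dec x; have [t [b [ht ->]]] := dec y.
rewrite !linearD !linearZ /= !(phiD1, phiD2, phiZ1, phiZ2) !TO //.
by rewrite (phiC12 (T w) (t l)) -(TO t) // (phiC12 w (T (t l))) (phiC12 w (T w)); ring.
Qed.

(** * Existence of a Lefschetz element in dimension four *)

Hypothesis dimV : \dim {:V} = 4%N.

Lemma ann_dim x : x != 0 -> (\dim (ann x) <= 3)%N.
Proof.
move=> x0; rewrite leqNgt; apply: contra x0 => d; apply/eqP/ann_full/eqP.
by rewrite eqEdim subvf dimV.
Qed.

(** For the algebra, this is a weak Lefschetz element: multiplication by [l] is injective on degree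
    one. *)
Definition lefschetz := exists l, ann l = 0%VS.

Lemma ann_add_ge3 x : \dim (ann x) = 3%N -> x \notin ann x -> forall z,
  exists y a, y \in ann x /\ z = y + a *: x.
Proof.
move=> d xx z; have /memv_addP[y yx [_ /vlineP[a ->] ->]] : z \in (ann x + <[x]>)%VS.
  suff -> : (ann x + <[x]>)%VS = fullv by rewrite memvf.
  apply/eqP; rewrite eqEdim subvf dimV -d ltn_neqAle dimvS ?addvSl // andbT.
  apply: contra xx; rewrite (dimv_leqif_eq (addvSl _ _)) => /eqP ->.
  by apply: (subvP (addvSr _ _)); apply: memv_line.
by exists y, a.
Qed.

(* If [ann y] has basis [y, p, q] and [v] is not in [ann y], then [ann l] vanishes
   for [l = v + a p + b q] unless the binary form [phi l] on [p, q] degenerates. *)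
Lemma rank1_lefschetz y : y != 0 -> y \in ann y -> \dim (ann y) = 3%N -> lefschetz.
Proof.
move=> y0 yy dy; apply: NNPP => noL.
pose U := (ann y :\: <[y]>)%VS.
have Uy : (U + <[y]> = ann y)%VS by rewrite addv_diff; apply/addv_idPl.
have capU : (U :&: <[y]> = 0)%VS by rewrite capv_diff.
have dimU : \dim U = 2%N.
  have := dimv_disjoint_sum capU; rewrite Uy dy dim_vline y0 => /eqP.
  by rewrite addn1 eqSS => /eqP.
have [p [q [pU qU Upq pq_free]]] := dim2_basis dimU.
have UA x : x \in U -> x \in ann y by rewrite -Uy; apply/subvP/addvSl.
have [v _ vA] : exists2 v, v \in fullv & v \notin ann y.
  by apply/subvPn; apply/negP => /dimvS; rewrite dimV dy.
have Av : (ann y + <[v]>)%VS = fullv.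
  apply/eqP; rewrite eqEdim subvf dimV -dy ltn_neqAle dimvS ?addvSl // andbT.
  apply: contra vA; rewrite (dimv_leqif_eq (addvSl _ _)) => /eqP ->.
  by apply: (subvP (addvSr _ _)); apply: memv_line.
have dec x : exists x1 x2 x0 x3, x = x1 *: p + x2 *: q + x0 *: y + x3 *: v.
  have : x \in (ann y + <[v]>)%VS by rewrite Av memvf.
  move=> /memv_addP[a + [_ /vlineP[x3 ->] ->]]; rewrite -Uy.
  move=> /memv_addP[b /Upq[x1 [x2 ->]] [_ /vlineP[x0 ->] ->]].
  by exists x1, x2, x0, x3.
have sym0 u z : u \in ann y -> (phi y u z = 0) * (phi u y z = 0) *
    (phi u z y = 0) * (phi z u y = 0) * (phi z y u = 0) * (phi y z u = 0).
  move=> /annP uy; do !split; rewrite ?uy //.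
  - by rewrite phiC12 uy.
  - by rewrite phiC23 phiC12 uy.
  - by rewrite phiC12 phiC23 phiC12 uy.
  - by rewrite phiC12 phiC23 uy.
  - by rewrite phiC23 uy.
have py z := sym0 _ z (UA _ pU); have qy z := sym0 _ z (UA _ qU).
have yyz z := sym0 _ z yy.
pose c := phi y v v.
have c0 : c != 0.
  apply: contraNneq vA => c0; apply/annP => z; have [x1 [x2 [x0 [x3 ->]]]] := dec z.
  by rewrite !(phiD3, phiZ3) !py !qy !yyz -/c c0; ring.
have vvy : phi v v y = c by rewrite phiC23 phiC12.
have vyv : phi v y v = c by rewrite phiC12.
have qpp : phi q p p = phi p p q by rewrite phiC12 phiC23.
have pqp : phi p q p = phi p p q by rewrite phiC23.
have qpq : phi q p q = phi p q q by rewrite phiC12.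
have qqp : phi q q p = phi p q q by rewrite phiC23 phiC12.
have vqp : phi v q p = phi v p q by rewrite phiC23.
have ppv : phi p p v = phi v p p by rewrite phiC23 phiC12.
have qpv : phi q p v = phi v p q by rewrite phiC23 phiC12 phiC23.
have pqv : phi p q v = phi v p q by rewrite phiC23 phiC12.
have qqv : phi q q v = phi v q q by rewrite phiC23 phiC12.
(* The Gram matrices are those of [phi v], [phi p] and [phi q] on the span of [p] and [q]; symmetry
   of [phi] makes the last two share entries. *)
have [| x1 [x2 [x12 [h1 h2 h3 h4 h5]]]] := @degenerate_common_kernel k (phi v p p)
    (phi v p q) (phi v q q) (phi p p p) (phi p p q) (phi p q q) (phi q q q).
  (* A nonzero [x] in [ann l] has no component along [v], by pairing with [y], and is then not a
     multiple of [y], by pairing with [v]. Its part in [p] and [q] is thus a nonzero radical vector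
     of the binary form. *)
  move=> a b; have : ann (v + (a *: p + b *: q)) != 0%VS.
    by apply/eqP => l0; apply: noL; eexists; apply: l0.
  rewrite -vpick0; set x := vpick _ => x0; have := memv_pick (ann (v + (a *: p + b *: q))).
  rewrite -/x => /annP xl.
  have [x1 [x2 [y1 [x3 xE]]]] := dec x.
  have x30 : x3 = 0.
    have := xl y; rewrite xE !(phiD1, phiD2, phiZ1, phiZ2) !py !qy !yyz vvy.
    by rewrite !mulr0 !add0r !addr0 => /eqP; rewrite mulf_eq0 (negPf c0) orbF => /eqP.
  have x12 : (x1, x2) != (0, 0).
    apply: contraNneq x0 => -[x10 x20]; have := xl v.
    rewrite xE x10 x20 x30 !scale0r !add0r addr0.
    rewrite !(phiD1, phiZ1) !phiZ2 py qy vyv !mulr0 !addr0 => /eqP.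
    by rewrite mulf_eq0 (negPf c0) orbF => /eqP ->; rewrite scale0r.
  move: (xl p) (xl q); rewrite xE x30 scale0r addr0.
  rewrite !(phiD1, phiD2, phiZ1, phiZ2) !py !qy => hp hq.
  apply: (det2_eq0 x12); [rewrite -[RHS]hp | rewrite -[RHS]hq];
    by rewrite !(pqp, qpp, qpq, qqp, vqp); ring.
have [p' p'E] : exists p', p' = x1 *: p + x2 *: q by eexists.
have p'p w : phi p' p w = 0.
  have [w1 [w2 [w0 [w3 ->]]]] := dec w.
  rewrite p'E !(phiD1, phiZ1, phiD3, phiZ3) !(pqp, qpp, qpq, qqp) ppv qpv ?py ?qy.
  transitivity (w1 * (x1 * phi p p p + x2 * phi p p q)
    + w2 * (x1 * phi p p q + x2 * phi p q q)
    + w3 * (x1 * phi v p p + x2 * phi v p q)); first by ring.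
  by rewrite h1 h3 h4; ring.
have p'q w : phi p' q w = 0.
  have [w1 [w2 [w0 [w3 ->]]]] := dec w.
  rewrite p'E !(phiD1, phiZ1, phiD3, phiZ3) !(pqp, qpp, qpq, qqp) pqv qqv !py !qy.
  transitivity (w1 * (x1 * phi p p q + x2 * phi p q q)
    + w2 * (x1 * phi p q q + x2 * phi q q q)
    + w3 * (x1 * phi v p q + x2 * phi v q q)); first by ring.
  by rewrite h2 h4 h5; ring.
have p'y w : phi p' y w = 0 by rewrite p'E phiD1 !phiZ1 py qy; ring.
(* Both [phi p'] and [phi y] vanish unless both arguments involve [v], so they are proportional;
   this puts [p'] on the line of [y], against [capU]. *)
have : c *: p' - phi p' v v *: y = 0.
  apply: phi_nondeg => z w; have [z1 [z2 [z0 [z3 ->]]]] := dec z.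
  rewrite -scaleNr !(phiD1, phiZ1) !(phiD2, phiZ2) p'p p'q p'y !py !qy !yyz.
  have [w1 [w2 [w0 [w3 ->]]]] := dec w.
  rewrite !(phiD3, phiZ3) !py !qy !yyz (phiC23 p' v p) p'p (phiC23 p' v q) p'q.
  by rewrite (phiC23 p' v y) p'y -/c; ring.
move=> p'0; have p'U : p' \in U by rewrite p'E rpredD ?rpredZ.
have : c *: p' \in (U :&: <[y]>)%VS.
  by rewrite memv_cap rpredZ //= (subr0_eq p'0) rpredZ // memv_line.
by rewrite capU memv0 scaler_eq0 (negPf c0) /= p'E => /eqP/pq_free[x10 x20];
  move: x12; rewrite x10 x20 eqxx.
Qed.

Lemma ann_ge3_lefschetz x : x != 0 -> x \in ann x -> (2 < \dim (ann x))%N -> lefschetz.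
Proof.
move=> x0 xx d; apply: (rank1_lefschetz x0 xx).
by apply/eqP; rewrite eqn_leq ann_dim.
Qed.

(** If [phi u] degenerates, take a nonzero [y] in [ann u]; then [ann y] contains the orbit of [u]
    and has dimension three. Either [y] lies in [ann y] and [rank1_lefschetz] applies, or [u + y] is
    a Lefschetz element: an element of its radical lies in [ann y] and is annihilated by the orbit
    and by [y], which span [V]. *)
Lemma orbit_ge3_lefschetz u : (2 < \dim (ev u @: S))%N -> lefschetz.
Proof.
move=> du; apply: NNPP => noL.
have : ann u != 0%VS by apply/eqP => u0; apply: noL; exists u.
rewrite -vpick0; set y := vpick _ => y0.
have yu : y \in ann u := memv_pick _.
have Oy := orbit_ann yu; have dy : \dim (ann y) = 3%N.
  by apply/eqP; rewrite eqn_leq ann_dim // (leq_trans du) ?dimvS.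
have [yy|yy] := boolP (y \in ann y); first exact: noL (rank1_lefschetz y0 yy dy).
have yyy : phi y y y != 0.
  apply: contra (yy) => /eqP y3; apply/annP => z.
  have [z1 [a [/annP z1y ->]]] := ann_add_ge3 dy yy z.
  by rewrite phiD3 phiZ3 y3 phiC23 z1y; ring.
apply: noL; exists (u + y); apply/eqP; rewrite -subv0; apply/subvP => x.
have [x1 [a [x1y ->]]] := ann_add_ge3 dy yy x; move=> /annP xl.
have xE z : phi u x1 z + a * phi y y z = 0.
  rewrite -[RHS](xl z) !(phiD1, phiD2, phiZ2).
  by rewrite (annP _ _ yu) (annP _ _ x1y); ring.
have a0 : a = 0.
  have := xE y; rewrite phiC23 (annP _ _ yu) add0r => /eqP.
  by rewrite mulf_eq0 (negPf yyy) orbF => /eqP.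
have x1u : x1 \in ann u by apply/annP => z; rewrite -[RHS](xE z) a0; ring.
rewrite a0 scale0r addr0 memv0; apply/eqP/ann_full/eqP.
have Ox1 := orbit_ann x1u; have yx1 : y \in ann x1 by rewrite annC.
have yO : y \notin (ev u @: S)%VS by apply: contra yy => /(subvP Oy).
have sub : (ev u @: S + <[y]> <= ann x1)%VS by rewrite subv_add Ox1.
rewrite eqEdim subvf dimV (leq_trans _ (dimvS sub)) //.
rewrite (leq_ltn_trans du) // ltn_neqAle dimvS ?addvSl // andbT.
apply: contra (yO); rewrite (dimv_leqif_eq (addvSl _ _)) => /eqP ->.
by apply: (subvP (addvSr _ _)); apply: memv_line.
Qed.

(* For [p a = a] the orbit of [a + b0] contains [a], [b0] and [t a], so that [t a]
   is a multiple of [a]; comparing [a] with [a + a0] shows that it is zero. *)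
Lemma orbit_idem_scalar p t a0 b0 : selfadj p -> (forall x, p (p x) = p x) ->
  (forall u, (\dim (ev u @: S) <= 2)%N) ->
  selfadj t -> p a0 = a0 -> t a0 = 0 -> a0 != 0 -> p b0 = 0 -> b0 != 0 -> t b0 = 0 ->
  forall x, t (p x) = 0.
Proof.
move=> hp pp small ht pa0 ta0 a00 pb0 b00 tb0 x.
have line a : p a = a -> a != 0 -> exists c, t a = c *: a.
  move=> pa an0; pose O := (ev (a + b0) @: S)%VS.
  have [pS tS] : p \in S /\ t \in S by split; apply/memS.
  have aO : a \in O by rewrite -[a]addr0 -{1}pa -pb0 -linearD mem_orbit.
  have b0O : b0 \in O.
    by rewrite -[b0](addKr a) addrC rpredB // mem_orbit_id.
  have taO : t a \in O by rewrite -[t a]addr0 -tb0 -linearD mem_orbit.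
  (* As [p] kills [b0], the image of [O] under [p] is at most a line, and it contains both [a] and
     [t a]. *)
  have kO : (\dim (O :&: lker p) > 0)%N.
    rewrite lt0n dimv_eq0; apply: contra b00 => /eqP O0.
    by rewrite -memv0 -O0 memv_cap b0O memv_ker pb0 eqxx.
  have : (\dim (p @: O) <= 1)%N.
    by have := small (a + b0); rewrite -/O -(limg_ker_dim p O); lia.
  have aeO : a \in (p @: O)%VS by rewrite -pa memv_img.
  have taeO : t a \in (p @: O)%VS by rewrite -[a]pa (selfadj_comm _ ht hp) memv_img.
  have aL : (<[a]> <= p @: O)%VS by rewrite -memvE.
  move=> d1; apply/vlineP; suff -> : (<[a]> = p @: O)%VS by [].
  by apply/eqP; rewrite eqEdim aL dim_vline an0.
have [->|px0] := eqVneq (p x) 0; first by rewrite linear0.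
have [c tc] := line _ (pp x) px0; rewrite tc.
have [pxa0|pxa0] := eqVneq (p x + a0) 0.
  by rewrite -tc -[p x](addrK a0) pxa0 sub0r linearN /= ta0 oppr0.
have [|d] := line _ _ pxa0; first by rewrite linearD /= pp pa0.
rewrite linearD /= ta0 addr0 => td.
(* Applying [t] once more gives [c = d] or [c = 0]; in the first case [td] leaves [c *: a0 = 0]. *)
have : t (t (p x)) = t (d *: (p x + a0)) by rewrite td.
rewrite {1}tc !linearZ /= linearD /= ta0 addr0 => /eqP.
rewrite tc -subr_eq0 -scalerBl !scaler_eq0 (negPf px0) orbF subr_eq0.
case/orP => [/eqP cd|/eqP -> //]; last by rewrite scale0r.
have [->|c0] := eqVneq c 0; first by rewrite scale0r.
move/eqP: td; rewrite tc cd -subr_eq0 -scalerBr opprD addrA subrr sub0r scalerN.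
by rewrite oppr_eq0 scaler_eq0 -cd (negPf c0) (negPf a00).
Qed.

Lemma limg_lker_ann s x y : selfadj s -> x \in limg s -> y \in lker s -> y \in ann x.
Proof.
move=> hs /memv_imgP[z _ ->]; rewrite memv_ker => /eqP sy0.
by apply/annP => w; rewrite hs sy0 phi02.
Qed.

(** All orbits have dimension at most two, so some nonzero [s] in [S] kills [u]. If the image and
    the kernel of [s] share a nonzero [x], their sum lies in [ann x], hence has dimension at most
    two, and both coincide by rank-nullity. Otherwise they split [V], and [orbit_idem_scalar] on
    both summands yields a nonzero element of [S] that is zero. *)
Lemma not_lefschetz_limg_lker : (2 < \dim S)%N -> ~ lefschetz ->
  forall u, u != 0 -> exists s, [/\ selfadj s, s u = 0, limg s = lker s & \dim (lker s) = 2%N].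
Proof.
move=> dS noL u u0.
have small v : (\dim (ev v @: S) <= 2)%N.
  by rewrite leqNgt; apply/negP => /orbit_ge3_lefschetz.
have killer v : exists t, [/\ selfadj t, t != 0 & t v = 0].
  have : (S :&: lker (ev v))%VS != 0%VS.
    rewrite -dimv_eq0 -lt0n.
    by rewrite -(ltn_add2r (\dim (ev v @: S))) limg_ker_dim (leq_ltn_trans (small v)).
  rewrite -vpick0 => t0; exists (vpick (S :&: lker (ev v))).
  have := memv_pick (S :&: lker (ev v)); rewrite memv_cap memv_ker evE.
  by case/andP => /memS ? /eqP ?.
have [s [hs s0 su]] := killer u; exists s; set W := limg s; set Y := lker s.
suff [] : W = Y /\ \dim Y = 2%N by [].
have dWY : (\dim Y + \dim W = 4)%N by rewrite -dimV -(limg_ker_dim s fullv) capfv.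
have WYann x y : x \in W -> y \in Y -> y \in ann x by apply: limg_lker_ann.
have two x : x != 0 -> x \in W -> x \in Y -> W = Y /\ \dim Y = 2%N.
  move=> x0 xW xY; have sub : (W + Y <= ann x)%VS.
    rewrite subv_add; apply/andP; split; apply/subvP => z zW; last exact: WYann.
    by rewrite annC WYann.
  have : (\dim (W + Y) <= 2)%N.
    rewrite leqNgt; apply/negP => d3; apply: noL; apply: (ann_ge3_lefschetz x0).
      exact: WYann.
    exact: leq_trans d3 (dimvS sub).
  move=> d2; have dW := dimvS (addvSl W Y); have dY := dimvS (addvSr W Y).
  have [W2 Y2] : \dim W = 2%N /\ \dim Y = 2%N by lia.
  split=> //; transitivity (W + Y)%VS; apply/eqP.
    by rewrite eqEdim addvSl W2.
  by rewrite eq_sym eqEdim addvSr Y2.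
have [WY0|] := eqVneq (W :&: Y)%VS 0%VS; last first.
  rewrite -vpick0 => x0; apply: (two _ x0); have := memv_pick (W :&: Y)%VS;
  by rewrite memv_cap => /andP[].
have WYV : (W + Y)%VS = fullv.
  by apply/eqP; rewrite eqEdim subvf dimv_disjoint_sum // dimV addnC dWY.
pose p : 'End(V) := daddv_pi W Y.
have pW x : p x \in W by apply: memv_pi.
have pY x : x - p x \in Y.
  by rewrite -{1}(@daddv_pi_add _ _ W Y x WY0) ?WYV ?memvf // addrC addKr memv_pi.
have pp x : p (p x) = p x by apply: daddv_pi_id.
(* The projection is self-adjoint because [W] and [Y] annihilate each other. *)
have hp : selfadj p.
  have ppE x y z : phi (p x) y z = phi (p x) (p y) z.
    rewrite -{1}[y](subrK (p y)) phiD2.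
    by rewrite (annP _ _ (WYann _ _ (pW x) (pY y))) add0r.
  by move=> x y z; rewrite ppE phiC12 -ppE phiC12.
have qE z : (\1%VF - p) z = z - p z.
  by rewrite add_lfunE opp_lfunE id_lfunE.
have hp' : selfadj (\1%VF - p).
  by move=> x y z; rewrite !qE -!scaleN1r !(phiD1, phiD2, phiZ1, phiZ2) hp.
have W0 : vpick W != 0.
  rewrite vpick0; apply: contra s0 => /eqP W0; apply/eqP/lfunP => x.
  by rewrite zero_lfunE; apply/eqP; rewrite -memv0 -W0 memv_img ?memvf.
have pW0 : p (vpick W) = vpick W by apply: daddv_pi_id; rewrite ?memv_pick.
have pu : p u = 0.
  apply/eqP; rewrite -memv0 -WY0 memv_cap pW /=.
  by rewrite -(subKr u (p u)) memvB // memv_ker su.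
(* Since [t] commutes with [p], killing the sum of a vector of [W] and one of [Y] means killing
   both. *)
have [t [ht t0 tWu]] := killer (vpick W + u).
have tW0 : t (vpick W) = 0.
  transitivity (p (t (vpick W + u))); last by rewrite tWu linear0.
  by rewrite (selfadj_comm _ hp ht) linearD /= pW0 pu addr0.
have tu : t u = 0 by have := tWu; rewrite linearD /= tW0 add0r.
case/eqP: t0; apply/lfunP => x; rewrite zero_lfunE -[x](subrK (p x)) linearD /=.
rewrite (orbit_idem_scalar hp pp small ht pW0 tW0 W0 pu u0 tu) addr0.
have qq x' : (\1%VF - p) ((\1%VF - p) x') = (\1%VF - p) x'.
  by rewrite !qE linearB /= pp subrr subr0.
have qu : (\1%VF - p) u = u by rewrite qE pu subr0.
have qW0 : (\1%VF - p) (vpick W) = 0 by rewrite qE pW0 subrr.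
by have := orbit_idem_scalar hp' qq small ht qu tu u0 qW0 W0 tW0 x; rewrite qE.
Qed.

(** Otherwise there are [s] and [t] with distinct planes [W] and [W'] as image and kernel. A common
    nonzero vector [x] would have [ann x] of dimension at least three; if the planes are
    complementary, [W] is the image of [s \o t = t \o s], hence contained in [W']. *)
Lemma ge3_lefschetz : (2 < \dim S)%N -> lefschetz.
Proof.
move=> dS; apply: NNPP => noL.
have ex := not_lefschetz_limg_lker dS noL.
have [u _ u0] : exists2 u : V, u \in fullv & u \notin 0%VS.
  by apply/subvPn; apply/negP => /dimvS; rewrite dimV dimv0.
have [|s [hs su sW dW]] := ex u; first by rewrite -memv0.
have [v _ vW] : exists2 v, v \in fullv & v \notin lker s.
  by apply/subvPn; apply/negP => /dimvS; rewrite dimV dW.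
have [|t [ht tv tW dtW]] := ex v; first by apply: contra vW => /eqP ->; rewrite mem0v.
set W := lker s in sW dW vW; set W' := lker t in tW dtW.
have vW' : v \in W' by rewrite memv_ker tv.
have WW' : (2 < \dim (W + W'))%N.
  rewrite -dW ltn_neqAle dimvS ?addvSl // andbT.
  apply: contra vW; rewrite (dimv_leqif_eq (addvSl _ _)) => /eqP ->.
  exact: (subvP (addvSr _ _)).
have WW'0 : (W :&: W')%VS = 0%VS.
  apply/eqP; rewrite -vpick0; apply: contraPT WW' => x0 WW'; apply: noL.
  have := memv_pick (W :&: W')%VS; rewrite memv_cap; set x := vpick _ => /andP[xW xW'].
  have WA z : z \in W -> z \in ann x by apply: limg_lker_ann => //; rewrite sW.
  have W'A z : z \in W' -> z \in ann x by apply: limg_lker_ann => //; rewrite tW.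
  apply: (ann_ge3_lefschetz x0); first exact: WA.
  by apply: leq_trans WW' (dimvS _); rewrite subv_add; apply/andP; split; apply/subvP.
have WV : (W + W')%VS = fullv.
  by apply/eqP; rewrite eqEdim subvf dimv_disjoint_sum // dimV dW dtW.
have : (W <= W')%VS.
  apply/subvP => x; rewrite -{1}sW => /memv_imgP[z _ ->].
  have /memv_addP[a aW [b bW' ->]] : z \in (W + W')%VS by rewrite WV memvf.
  move: aW; rewrite memv_ker linearD /= => /eqP ->; rewrite add0r.
  move: bW'; rewrite -tW => /memv_imgP[c _ ->].
  by rewrite (selfadj_comm _ hs ht) memv_img ?memvf.
by move/capv_idPl; rewrite WW'0 => W0; move: dW; rewrite -W0 dimv0.
Qed.

Lemma selfadj_dim : [\/ \dim S = 1%N, \dim S = 2%N | \dim S = 4%N].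
Proof.
have S1 : (0 < \dim S)%N.
  rewrite lt0n dimv_eq0; apply/eqP => S0; have := selfadj_id; rewrite S0 memv0.
  move=> /eqP id0; have [u _] : exists2 u : V, u \in fullv & u \notin 0%VS.
    by apply/subvPn; apply/negP => /dimvS; rewrite dimV dimv0.
  by rewrite memv0 -[u]id_lfunE id0 zero_lfunE eqxx.
have [dS|] := leqP (\dim S) 2.
  by move: S1 dS; case: (\dim S) => [|[|[|]]] // _ _; [apply: Or31 | apply: Or32].
move=> dS; have [l l0] := ge3_lefschetz dS.
have := lefschetz_dim_neq l0; have := lefschetz_orbit_dim l0.
have := dimvS (subvf (ev l @: S)); rewrite dimV => d4 dO d3.
by apply: Or33; move: dS d4 d3; rewrite dO; case: (\dim S) => [|[|[|[|[|]]]]].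
Qed.

End TrilinearForm.

(** * Linear algebra and homogeneous polynomials *)

(** Starting from zero, adjoin vectors of [P] as long as one lies outside the subspace; [n] bounds
    the codimension. Membership in [P] is decided classically. *)
Lemma vspace_of_pred (k : fieldType) (V : vectType k) (P : V -> Prop) :
  P 0 -> (forall a x y, P x -> P y -> P (a *: x + y)) ->
  exists U : {vspace V}, forall v, v \in U <-> P v.
Proof.
move=> P0 Plin.
suff grow n (U : {vspace V}) : (\dim {:V} - \dim U <= n)%N ->
    (forall v, v \in U -> P v) -> exists U : {vspace V}, forall v, v \in U <-> P v.
  by apply: (grow _ 0%VS (leqnn _)) => v; rewrite memv0 => /eqP ->.
elim: n U => [|n IHn] U dU UP.
  exists fullv => v; split=> [_|_]; last exact: memvf.
  apply: UP; have /eqP -> : U == fullv; last exact: memvf.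
  by rewrite eqEdim subvf -subn_eq0 -leqn0.
have [[v [Pv vU]]|noV] := classic (exists v, P v /\ v \notin U); last first.
  exists U => v; split=> [/UP //|Pv]; apply: contraPT (noV) => vU; apply.
  by exists v.
apply: (IHn (U + <[v]>)%VS) => [|w /memv_addP[u uU [_ /vlineP[a ->] ->]]].
  have ltU : (\dim U < \dim (U + <[v]>))%N.
    rewrite ltn_neqAle dimvS ?addvSl // andbT.
    apply: contra vU; rewrite (dimv_leqif_eq (addvSl _ _)) => /eqP ->.
    by apply: (subvP (addvSr _ _)); apply: memv_line.
  by rewrite -ltnS (leq_trans _ dU) // ltn_sub2l // (leq_trans ltU) ?dimvS ?subvf.
by rewrite addrC; apply: Plin Pv (UP u uU).
Qed.

(** Project along [U] onto a complement, then take a coordinate that does not vanish at the image of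
    [v]. *)
Lemma separating_functional (k : fieldType) (V : vectType k) (U : {vspace V}) v :
  v \notin U -> exists g : 'Hom(V, k^o), (forall u, u \in U -> g u = 0) /\ g v != 0.
Proof.
move=> vU; have UV w : w \in (U + U^C)%VS by rewrite addv_complf memvf.
have dec w := daddv_pi_add (capv_compl U) (UV w).
pose p := daddv_pi (U^C)%VS U.
have pU u : u \in U -> p u = 0.
  by move=> uU; apply: (addrI u); rewrite -{1}(daddv_pi_id (capv_compl U) uU) dec addr0.
have pv : p v != 0.
  by apply: contra vU => /eqP pv0; rewrite -(dec v) -/p pv0 addr0 memv_pi.
pose b := vbasis {:V}.
have [i ci] : exists i, coord b i (p v) != 0.
  apply/existsP; apply: contraR pv => /existsPn c0.
  rewrite (coord_vbasis (memvf (p v))) big1 // => i _.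
  by have := c0 i; rewrite negbK => /eqP ->; rewrite scale0r.
exists (linfun ((coord b i : V -> k^o) \o p)); split=> [u uU|]; rewrite lfunE //=.
by rewrite pU // linear0.
Qed.

(** Were the family not free, some vector would lie in the span of the later ones and could be
    dropped. *)
Lemma irredundant_sum_dim (k : fieldType) (V : vectType k) n (w : 'I_n -> V) (U : {vspace V}) :
  (\sum_i <[w i]>)%VS = U ->
  (forall i, ~ (U <= \sum_(j | j != i) <[w j]>)%VS) -> n = \dim U.
Proof.
move=> sumU irr; pose X := [tuple of map w (ord_tuple n)].
have Xi (i : 'I_n) : X`_i = w i by rewrite -tnth_nth tnth_map tnth_ord_tuple.
have spanX : <<X>>%VS = U.
  by rewrite -sumU span_def big_map big_enum.
have [fX|] := boolP (free X).
  by rewrite -spanX (eqP fX) size_tuple.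
rewrite freeNE => /existsP[i]; rewrite Xi => wi.
case: (irr i); rewrite -sumU; apply/subv_sumP => j _.
have [->|ji] := eqVneq j i; last exact: (sumv_sup j).
rewrite -memvE; apply: subvP wi; apply/span_subvP => x /(nthP 0)[l].
rewrite size_drop size_tuple nth_drop => ln <-.
have il : (i.+1 + l < n)%N by rewrite -ltn_subRL.
rewrite (Xi (Ordinal il)) memvE (sumv_sup (Ordinal il)) //.
by rewrite -val_eqE /= neq_ltn ltnS leq_addr orbT.
Qed.

Section Homogeneous.
Variables (n : nat) (R : comNzRingType).
Implicit Types p q : {mpoly R[n]}.

(** Every monomial of positive degree splits off a variable. *)
Lemma homogS_ind d (Q : {mpoly R[n]} -> Prop) :
  Q 0 -> (forall p q, Q p -> Q q -> Q (p + q)) ->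
  (forall i q, q \is d.-homog -> Q ('X_i * q)) ->
  forall p, p \is d.+1.-homog -> Q p.
Proof.
move=> Q0 QD QX p /dhomogP hp; rewrite [p]mpolyE big_seq; apply: big_ind => // m /hp /= dm.
have [i mi] : exists i, m i != 0%N.
  apply/existsP; apply: contra_eqT dm => /existsPn m0.
  rewrite (_ : m = 0%MM) ?mdeg0 //; apply/mnmP => i; rewrite mnm0E.
  by apply/eqP; have := m0 i; rewrite negbK.
have Em : (U_(i) + (m - U_(i)) = m)%MM by rewrite addmC submK // lep1mP.
rewrite -{2}Em mpolyXD scalerAr; apply: QX; apply: rpredZ; rewrite dhomogX /=.
by apply/eqP; move: dm; rewrite -{1}Em mdegD mdeg1 => -[].
Qed.

Definition hproj d p : dhomog n R d := DHomog (pihomogP mdeg d p).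

Lemma hproj_is_linear d : linear (hproj d).
Proof. by move=> a p q; apply: val_inj; rewrite /= linearP. Qed.

HB.instance Definition _ d :=
  GRing.isLinear.Build R {mpoly R[n]} (dhomog n R d) _ (hproj d) (hproj_is_linear d).

Definition hvar i : dhomog n R 1 :=
  @DHomog n R 1 'X_i (etrans (dhomogX _ _ _ _) (introT eqP (mdeg1 i))).

Lemma linear_formE (x : dhomog n R 1) : x = \sum_i (val x)@_U_(i) *: hvar i.
Proof.
apply: val_inj; rewrite linear_sum /=; apply/mpolyP => m; rewrite linear_sum /=.
case: (eqVneq (mdeg m) 1%N) => [/eqP/mdeg1P[j /eqP ->]|dm]; last first.
  rewrite (dhomog_nemf_coeff (dhomog_is_dhomog x) dm) big1 // => i _.
  rewrite linearZ /= mcoeffX; have -> : (U_(i)%MM == m) = false; last by rewrite mulr0.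
  by apply: contraNF dm => /eqP <-; rewrite mdeg1.
rewrite (bigD1 j) //= big1 ?addr0 => [|i ij]; rewrite mcoeffZ mcoeffXU ?eqxx ?mulr1 //.
by rewrite (negPf ij) mulr0.
Qed.

Definition hmul d d' (p : dhomog n R d) (q : dhomog n R d') : dhomog n R (d + d') :=
  DHomog (dhomogM (dhomog_is_dhomog p) (dhomog_is_dhomog q)).

Lemma hmul_is_linear d d' (p : dhomog n R d) : linear (@hmul d d' p).
Proof. by move=> a q q'; apply: val_inj; rewrite /= mulrDr -scalerAr. Qed.

HB.instance Definition _ d d' (p : dhomog n R d) := GRing.isLinear.Build R (dhomog n R d')
  (dhomog n R (d + d')) _ (@hmul d d' p) (hmul_is_linear p).

Lemma hmulDZl d d' a (p p' : dhomog n R d) (q : dhomog n R d') :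
  hmul (a *: p + p') q = a *: hmul p q + hmul p' q.
Proof. by apply: val_inj; rewrite /= mulrDl -scalerAl. Qed.

Lemma hprojK d (p : dhomog n R d) : hproj d (val p) = p.
Proof. by apply: val_inj; apply: (pihomog_dE (dhomog_is_dhomog p)). Qed.

Lemma hproj_ne d d' (p : dhomog n R d') : d' != d -> hproj d (val p) = 0.
Proof. by move=> dd; apply/val_inj/(pihomog_ne0 dd)/dhomog_is_dhomog. Qed.

Lemma pihomogM e d q p : q \is e.-homog ->
  pihomog mdeg (e + d) (q * p) = q * pihomog mdeg d p.
Proof.
(* The bound exceeds [d] so that the component of degree [d] occurs in the sum even when it is
   beyond the degree of [p]. *)
move=> hq; pose N := maxn d.+1 (mmeasure mdeg p).
have dN : (d < N)%N by rewrite leq_max leqnn.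
have qpi i : q * pihomog mdeg i p \is (e + i).-homog.
  by apply: dhomogM => //; apply: pihomogP.
rewrite {1}(@pihomog_partitionE _ _ mdeg N p) ?leq_maxr // mulr_sumr linear_sum /=.
rewrite (bigD1 (Ordinal dN)) //= big1 => [|i id]; first by rewrite addr0 pihomog_dE.
by rewrite (pihomog_ne0 _ (qpi i)) // eqn_add2l.
Qed.

Lemma dhomog0_const p : p \is 0.-homog -> p = (p@_0)%:MP.
Proof.
move=> hp; apply/mpolyP => m; rewrite mcoeffC.
have [<-|m0] := eqVneq 0%MM m; first by rewrite mulr1.
by rewrite mulr0 (dhomog_nemf_coeff hp) //= mdeg_eq0 eq_sym.
Qed.

End Homogeneous.

(** * Minimal generators of the annihilator of a cubic form *)

Section CubicForm.
Variables (k : fieldType) (f : {linear {mpoly k[4]} -> k^o}).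

Local Notation H d := (dhomog 4 k d).

(** On cubics, [f] is the Macaulay dual generator; as a functional, rather than a polynomial, it
    makes sense in every characteristic. *)
Definition cubic_phi (x y z : H 1) : k := f (val x * val y * val z).

Hypothesis f_nondeg : forall x : H 1,
  (forall y z : H 1, f (val x * val y * val z) = 0) -> x = 0.

Lemma cubic_phi_linear a x x' y z :
  cubic_phi (a *: x + x') y z = a * cubic_phi x y z + cubic_phi x' y z.
Proof. by rewrite /cubic_phi /= !mulrDl -!scalerAl linearP. Qed.

Lemma cubic_phiC12 x y z : cubic_phi x y z = cubic_phi y x z.
Proof. by rewrite /cubic_phi (mulrC (val x)). Qed.

Lemma cubic_phiC23 x y z : cubic_phi x y z = cubic_phi x z y.
Proof. by rewrite /cubic_phi mulrAC. Qed.

(** * The catalecticant and the quadrics of the ideal *)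

Lemma dim_H1 : \dim {:H 1} = 4%N. Proof. by rewrite dimvf. Qed.
Lemma dim_H2 : \dim {:H 2} = 10%N. Proof. by rewrite dimvf. Qed.

Definition catalecticant_fun (q : H 2) : 'rV[k]_4 := \row_i f ('X_i * val q).

Lemma catalecticant_is_linear : linear catalecticant_fun.
Proof.
move=> a p q; apply/rowP => i.
by rewrite !mxE /= mulrDr -scalerAr linearP.
Qed.

HB.instance Definition _ := GRing.isLinear.Build k (H 2) 'rV[k]_4 _
  catalecticant_fun catalecticant_is_linear.

Definition catalecticant : 'Hom(H 2, 'rV[k]_4) := linfun catalecticant_fun.

Lemma f_linear_form (x : H 1) (p : {mpoly k[4]}) :
  f (val x * p) = \sum_i (val x)@_U_(i) * f ('X_i * p).
Proof.
rewrite {1}(linear_formE x) linear_sum /= mulr_suml linear_sum /=.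
by apply: eq_bigr => i _; rewrite -scalerAl linearZ.
Qed.

Lemma catalecticant_eq0 (q : H 2) :
  catalecticant q = 0 <-> forall x : H 1, f (val x * val q) = 0.
Proof.
rewrite lfunE; split=> [/rowP q0 x|q0].
  by rewrite f_linear_form big1 // => i _; have := q0 i; rewrite !mxE => ->; rewrite mulr0.
by apply/rowP => i; rewrite !mxE; apply: (q0 (hvar _ i)).
Qed.

Lemma linear_rV n (g : 'Hom('rV[k]_n, k^o)) (v : 'rV[k]_n) :
  g v = \sum_i v 0 i * g (delta_mx 0 i).
Proof.
by rewrite {1}(row_sum_delta v) linear_sum; apply: eq_bigr => i _; rewrite linearZ.
Qed.

Lemma linear_form_eq0 (a : 'I_4 -> k) :
  \sum_i a i *: hvar k i = 0 :> H 1 -> forall i, a i = 0.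
Proof.
move=> /(congr1 (fun x : H 1 => val x)) a0 j.
have : (val (\sum_i a i *: hvar k i))@_U_(j) = 0 by rewrite a0 mcoeff0.
rewrite linear_sum /= linear_sum /= (bigD1 j) //= big1 => [|i ij].
  by rewrite addr0 mcoeffZ mcoeffXU eqxx mulr1.
by rewrite mcoeffZ mcoeffXU (negPf ij) mulr0.
Qed.

(** A functional vanishing on the image is the coefficient vector of a linear form [x] with
    [f (x * y * z) = 0] for all [y] and [z]. *)
Lemma catalecticant_limg : limg catalecticant = fullv.
Proof.
apply/eqP; apply: contraT => notfull.
have [w _ wL] : exists2 w : 'rV[k]_4, w \in fullv & w \notin limg catalecticant.
  by apply/subvPn; apply: contra notfull => fL; rewrite eqEsubv subvf.
have [g [g0 /eqP[]]] := separating_functional wL.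
pose x : H 1 := \sum_i g (delta_mx 0 i) *: hvar k i.
have x0 : x = 0.
  apply: f_nondeg => y z; rewrite -mulrA -[RHS](g0 (catalecticant (hmul y z))) ?memv_img ?memvf //.
  rewrite linear_rV /x linear_sum mulr_suml linear_sum; apply: eq_bigr => i _.
  by rewrite lfunE mxE -scalerAl linearZ; apply: mulrC.
by rewrite linear_rV big1 // => i _; rewrite (linear_form_eq0 x0) mulr0.
Qed.

Lemma catalecticant_dim : \dim (lker catalecticant) = 6%N.
Proof.
have := limg_ker_dim catalecticant fullv; rewrite capfv catalecticant_limg dim_H2.
by rewrite dimvf => /(@addIn 4 _ 6).
Qed.

(** * Twists of the cubic form by self-adjoint endomorphisms *)

Definition cubic_functional (c : 'X_{1..4} -> k) (p : {mpoly k[4]}) : k^o :=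
  \sum_(m : 'X_{1..4 < 4} | mdeg m == 3%N) p@_m * c m.

Lemma cubic_functional_is_linear c : linear (cubic_functional c).
Proof.
move=> a p q; rewrite /cubic_functional scaler_sumr -big_split.
by apply: eq_bigr => m _ /=; rewrite mcoeffD mcoeffZ mulrDl -mulrA.
Qed.

HB.instance Definition _ c := GRing.isLinear.Build k {mpoly k[4]} k^o _
  (cubic_functional c) (cubic_functional_is_linear c).

Lemma cubic_functionalX c m : mdeg m = 3%N -> cubic_functional c 'X_[m] = c m.
Proof.
move=> dm; have lt4 : (mdeg m < 4)%N by rewrite dm.
rewrite /cubic_functional (bigD1 (BMultinom lt4)) /= ?dm // big1 ?addr0.
  by rewrite mcoeffX eqxx mul1r.
move=> u /andP[_ um]; rewrite mcoeffX (_ : _ == _ = false) ?mul0r //.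
by apply: contraNF um => /eqP mu; apply/eqP/val_inj.
Qed.


(* A self-adjoint [s] turns [f] into the cubic form [x y z |-> f (s x * y * z)];
   on a monomial [s] is applied to an arbitrary variable occurring in it. *)
Definition twist_coef (s : 'End(H 1)) (m : 'X_{1..4}) : k :=
  if [pick i | m i != 0%N] is Some i then f (val (s (hvar k i)) * 'X_[m - U_(i)])
  else 0.

Definition twist (s : 'End(H 1)) : {linear {mpoly k[4]} -> k^o} :=
  cubic_functional (twist_coef s).

(** The variable picked may be some [j] other than [i]; self-adjointness moves [s] from one to the
    other. *)
Lemma twist_coefE s i m : selfadj cubic_phi s -> mdeg m = 2%N ->
  twist_coef s (U_(i) + m) = f (val (s (hvar k i)) * 'X_[m]).
Proof.
move=> hs dm; rewrite /twist_coef; case: pickP => [j|/(_ i)]; last first.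
  by rewrite mnmDE mnm1E eqxx.
have [<- _|ij] := eqVneq i j; first by rewrite addmC addmK.
rewrite mnmDE mnm1E (negPf ij) add0n => mj.
have mE : m = (m - U_(j) + U_(j))%MM by rewrite submK // lep1mP.
set u := (m - U_(j))%MM in mE.
have du : mdeg u == 1%N by have := dm; rewrite {1}mE mdegD mdeg1 addn1 => -[->].
have uh : ('X_[u] : {mpoly k[4]}) \is 1.-homog by rewrite dhomogX.
have /= := hs (hvar k i) (hvar k j) (DHomog uh); rewrite /cubic_phi /= => E.
rewrite mE addmA addmK !mpolyXD mulrA [_ * 'X_i]mulrC -E; congr (f _).
by rewrite [_ * 'X_j]mulrC mulrA.
Qed.

Lemma twistM s (x : H 1) (q : H 2) : selfadj cubic_phi s ->
  twist s (val x * val q) = f (val (s x) * val q).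
Proof.
move=> hs; rewrite {1 2}(linear_formE x) !linear_sum /= !mulr_suml !linear_sum.
apply: eq_bigr => i _ /=; rewrite !linearZ /= -!scalerAl !linearZ; congr (_ *: _).
case: q => q /= /dhomogP hq; rewrite [q]mpolyE !mulr_sumr !linear_sum.
apply: eq_big_seq => m /hq dm; rewrite -!scalerAr !linearZ -mpolyXD; congr (_ *: _).
by rewrite /twist /= cubic_functionalX ?mdegD ?mdeg1 ?dm // twist_coefE.
Qed.

Lemma twist_id (p : H 3) : twist \1%VF (val p) = f (val p).
Proof.
have id1 : selfadj cubic_phi \1%VF by move=> x y z; rewrite !id_lfunE.
apply: (@homogS_ind _ _ 2 (fun p => twist \1%VF p = f p)); last exact: dhomog_is_dhomog.
- by rewrite !linear0.
- by move=> q q' hq hq'; rewrite !linearD hq hq'.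
- move=> i q hq; have := twistM (hvar k i) (DHomog hq) id1.
  by rewrite id_lfunE.
Qed.

Lemma twist_coef_linear a s t m :
  twist_coef (a *: s + t) m = a * twist_coef s m + twist_coef t m.
Proof.
rewrite /twist_coef; case: pickP => [i _|_]; last by rewrite mulr0 addr0.
by rewrite add_lfunE scale_lfunE /= mulrDl -scalerAl linearP.
Qed.

Lemma twist_sum n (a : 'I_n -> k) (s : 'I_n -> 'End(H 1)) p :
  twist (\sum_i a i *: s i) p = \sum_i a i * twist (s i) p.
Proof.
have lin b t u : twist (b *: t + u) p = b * twist t p + twist u p.
  rewrite /twist /= /cubic_functional mulr_sumr -big_split; apply: eq_bigr => m _ /=.
  by rewrite twist_coef_linear mulrDr mulrCA.
have t0 : twist 0 p = 0.
  by apply: (addrI (twist 0 p)); rewrite -{1}[twist 0 p]mul1r -lin scale1r !addr0.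
elim: n a s => [|n IHn] a s; first by rewrite !big_ord0.
by rewrite !big_ord_recl lin IHn.
Qed.

Variable S : {vspace 'End(H 1)}.
Hypothesis memS : forall s, s \in S <-> selfadj cubic_phi s.

Let basisS (a : 'I_(\dim S)) : 'End(H 1) := (vbasis S)`_a.

Lemma basisS_selfadj a : selfadj cubic_phi (basisS a).
Proof. by apply/memS/vbasis_mem; rewrite mem_nth // size_tuple. Qed.

(** A cubic [p] seen as the functional sending [s] to [twist s p], hence as an element of the dual
    of [S]. *)
Definition twists_fun (p : H 3) : 'rV[k]_(\dim S) :=
  \row_a twist (basisS a) (val p).

Lemma twists_is_linear : linear twists_fun.
Proof. by move=> a p q; apply/rowP => i; rewrite !mxE linearP. Qed.

HB.instance Definition _ := GRing.isLinear.Build k (H 3) 'rV[k]_(\dim S) _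
  twists_fun twists_is_linear.

Definition twists : 'Hom(H 3, 'rV[k]_(\dim S)) := linfun twists_fun.

Lemma twistsE s (p : H 3) : s \in S ->
  twist s (val p) = \sum_a coord (vbasis S) a s * twists p 0 a.
Proof.
move=> sS; rewrite {1}(coord_vbasis sS) twist_sum.
by apply: eq_bigr => a _; rewrite lfunE mxE.
Qed.

(** Let a functional [G] on cubics vanish on those of [J]. Then [G (x * q)] depends on [q] only
    through its catalecticant, so it equals [f (s x * q)] for an endomorphism [s], self-adjoint by
    commutativity. Hence [G] is [twist s] and vanishes at [p]. *)
Lemma twists_eq0 (J : {mpoly k[4]} -> Prop) : is_ideal J ->
  (forall q : H 2, q \in lker catalecticant -> J (val q)) ->
  forall p : H 3, twists p = 0 -> J (val p).
Proof.
move=> [J0 JD JM] JI p p0.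
have [C memC] : exists C : {vspace H 3}, forall v, v \in C <-> J (val v).
  apply: vspace_of_pred => //= a x y Jx Jy; apply: JD => //.
  by rewrite -mul_mpolyC; apply: JM.
apply/memC; apply: contraT => /separating_functional[G [G0 /eqP[]]].
pose inv := (catalecticant^-1)%VF.
(* The coefficient at the variable [i] is the value of [G] at [x] times a quadric whose
   catalecticant is the unit vector [i]. *)
pose sf (x : H 1) : H 1 := \sum_i G (hmul x (inv (delta_mx 0 i))) *: hvar k i.
have sf_linear : linear sf.
  move=> a x y; rewrite /sf scaler_sumr -big_split; apply: eq_bigr => i _ /=.
  by rewrite hmulDZl linearP scalerDl scalerA.
pose s : 'End(H 1) := linfun (HB.pack_for {linear H 1 -> H 1} sf
  (GRing.isLinear.Build k (H 1) (H 1) _ sf sf_linear)).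
have sE (x : H 1) (q : H 2) : G (hmul x q) = f (val (s x) * val q).
  pose q' := inv (catalecticant q).
  have -> : G (hmul x q) = G (hmul x q').
    apply: subr0_eq; rewrite -linearB; apply: G0; apply/memC.
    have -> : hmul x q - hmul x q' = hmul x (q - q') by rewrite linearB.
    apply: (JM (val x) (val (q - q'))); apply: JI.
    by rewrite memv_ker linearB /= limg_lfunVK ?memv_img ?memvf // subrr.
  have -> : q' = \sum_i f ('X_i * val q) *: inv (delta_mx 0 i).
    rewrite /q' (row_sum_delta (catalecticant q)) linear_sum.
    by apply: eq_bigr => i _; rewrite linearZ lfunE mxE.
  rewrite /s lfunE /= /sf !linear_sum /= mulr_suml linear_sum.
  apply: eq_bigr => i _ /=; rewrite !linearZ /= -scalerAl linearZ.
  exact: mulrC.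
have sS : s \in S.
  apply/memS => x y z; rewrite cubic_phiC12 [RHS]cubic_phiC12 /cubic_phi.
  rewrite [val y * _]mulrC -!mulrA -(sE x (hmul y z)) -(sE y (hmul x z)).
  by congr (G _); apply: val_inj; rewrite /= mulrCA.
have GE (r : {mpoly k[4]}) : r \is 3.-homog -> G (hproj 3 r) = twist s r.
  apply: (@homogS_ind _ _ 2 (fun r => G (hproj 3 r) = twist s r)).
  - by rewrite !linear0.
  - by move=> q q' hq hq'; rewrite !linearD /= hq hq'.
  - move=> i q hq; rewrite (twistM (hvar k i) (DHomog hq)); last exact/memS.
    rewrite -sE; congr (G _); apply: val_inj; apply: pihomog_dE.
    exact: (dhomog_is_dhomog (hmul (hvar k i) (DHomog hq))).
rewrite -(hprojK p) GE ?dhomog_is_dhomog // [LHS](twistsE p sS) p0 big1 // => a _.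
by rewrite mxE mulr0.
Qed.

(** A functional vanishing on the image is an [s] in [S] whose twist is zero on cubics; then
    [f (s x * y * z) = 0], so [s = 0]. *)
Lemma twists_limg : limg twists = fullv.
Proof.
apply/eqP; apply: contraT => notfull.
have [w _ wL] : exists2 w : 'rV[k]_(\dim S), w \in fullv & w \notin limg twists.
  by apply/subvPn; apply: contra notfull => fL; rewrite eqEsubv subvf.
have [g [g0 /eqP[]]] := separating_functional wL.
pose s := \sum_a g (delta_mx 0 a) *: basisS a.
have hs : selfadj cubic_phi s.
  by apply/memS; apply: rpred_sum => a _; apply: rpredZ; apply/memS/basisS_selfadj.
have s0 : s = 0.
  apply/lfunP => x; rewrite zero_lfunE; apply: f_nondeg => y z.
  rewrite -mulrA -(twistM x (hmul y z) hs) /s twist_sum.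
  rewrite -[RHS](g0 (twists (hmul x (hmul y z)))) ?memv_img ?memvf // linear_rV.
  by apply: eq_bigr => a _; rewrite lfunE mxE mulrC.
have /freeP fS := basis_free (vbasisP S).
by rewrite linear_rV big1 // => a _; rewrite (fS _ s0) mulr0.
Qed.

(** Evaluation at the identity of an element of the dual of [S]. Its kernel is the dual of [S / k],
    and by [f_twists] it recovers [f]. *)
Definition unit_coord (v : 'rV[k]_(\dim S)) : k^o :=
  \sum_a coord (vbasis S) a \1%VF * v 0 a.

Lemma unit_coord_is_linear : linear unit_coord.
Proof.
move=> a u v; rewrite /unit_coord scaler_sumr -big_split; apply: eq_bigr => i _ /=.
by rewrite !mxE mulrDr mulrCA.
Qed.

HB.instance Definition _ := GRing.isLinear.Build k 'rV[k]_(\dim S) k^o _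
  unit_coord unit_coord_is_linear.

Lemma id_selfadj : \1%VF \in S.
Proof. by apply/memS => x y z; rewrite !id_lfunE. Qed.

Lemma f_twists (p : H 3) : f (val p) = unit_coord (twists p).
Proof. by rewrite -twist_id (twistsE _ id_selfadj). Qed.

Lemma unit_coord_surj (t : k) : exists v, unit_coord v = t.
Proof.
have [a ca] : exists a, coord (vbasis S) a \1%VF != 0.
  apply/existsP; apply: contraT => /existsPn c0.
  have : \1%VF != 0 :> 'End(H 1).
    apply/eqP => /lfunP/(_ (hvar k 0)); rewrite id_lfunE zero_lfunE => /(congr1 val) /=.
    move=> /(congr1 (mcoeff U_(0))); rewrite mcoeffXU eqxx mcoeff0 => /eqP.
    by rewrite oner_eq0.
  rewrite (coord_vbasis id_selfadj) big1 ?eqxx // => a _.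
  by have := c0 a; rewrite negbK => /eqP ->; rewrite scale0r.
exists ((t / coord (vbasis S) a \1%VF) *: delta_mx 0 a).
rewrite /unit_coord (bigD1 a) //= big1 => [|b ba]; rewrite !mxE eqxx /=.
  by rewrite eqxx mulr1 addr0 mulrC divfK.
by rewrite (negPf ba) !mulr0.
Qed.

(** * The space of minimal generators *)

Definition constraint_fun (u : H 2 * 'rV[k]_(\dim S)) : 'rV[k]_4 * k^o :=
  (catalecticant u.1, unit_coord u.2).

Lemma constraint_is_linear : linear constraint_fun.
Proof. by move=> a u v; rewrite /constraint_fun /= !linearP. Qed.

HB.instance Definition _ := GRing.isLinear.Build k (H 2 * 'rV[k]_(\dim S))%type
  ('rV[k]_4 * k^o)%type _ constraint_fun constraint_is_linear.

(* Identified with [I / (x_0, .., x_3) I] by [gen_class] below. *)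
Definition gen_space : {vspace H 2 * 'rV[k]_(\dim S)} := lker (linfun constraint_fun).

Lemma mem_gen_space q v : ((q, v) \in gen_space) = (catalecticant q == 0) && (unit_coord v == 0).
Proof. by rewrite memv_ker lfunE. Qed.

Lemma dim_gen_space : \dim gen_space = (\dim S + 5)%N.
Proof.
have full : limg (linfun constraint_fun) = fullv.
  apply/eqP; rewrite eqEsubv subvf; apply/subvP => -[w t] _.
  have [v vt] := unit_coord_surj t.
  have /memv_imgP[q _ ->] : w \in limg catalecticant by rewrite catalecticant_limg memvf.
  have -> : (catalecticant q, t) = linfun constraint_fun (q, v).
    by rewrite -vt [RHS]lfunE.
  by rewrite memv_img ?memvf.
have := limg_ker_dim (linfun constraint_fun) fullv; rewrite capfv full !dimvf -/gen_space.
have -> : dim ('rV[k]_4 * k^o)%type = 5 by [].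
have -> : dim (H 2 * 'rV[k]_(\dim S))%type = (10 + 1 * \dim S)%N by [].
by rewrite mul1n => E; apply: (@addIn 5); rewrite [LHS]E -addnA addnC.
Qed.

Lemma dim_ker_unit_coord : (\dim (lker (linfun unit_coord))).+1 = \dim S.
Proof.
have full : limg (linfun unit_coord) = fullv.
  apply/eqP; rewrite eqEsubv subvf; apply/subvP => t _.
  have [v <-] := unit_coord_surj t.
  by rewrite -[unit_coord v]lfunE memv_img ?memvf.
have := limg_ker_dim (linfun unit_coord) fullv; rewrite capfv full !dimvf.
have -> : dim 'rV[k]_(\dim S) = (1 * \dim S)%N by [].
have -> : dim k^o = 1%N by [].
by rewrite mul1n addn1.
Qed.

(** Through [twists] the cubic part counts only modulo multiples of the quadrics of the ideal;
    higher degrees drop out because the ideal is generated in degrees two and three. *)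
Definition gen_class (p : {mpoly k[4]}) : H 2 * 'rV[k]_(\dim S) :=
  (hproj 2 p, twists (hproj 3 p)).

Lemma gen_class_is_linear : linear gen_class.
Proof. by move=> a p q; rewrite /gen_class !linearP. Qed.

HB.instance Definition _ := GRing.isLinear.Build k {mpoly k[4]}
  (H 2 * 'rV[k]_(\dim S))%type _ gen_class gen_class_is_linear.

Variable I : {mpoly k[4]} -> Prop.
Hypothesis idealI : is_ideal I.
(** [I] is the apolar ideal of [f]: it contains every form of degree at least four. *)
Hypothesis memI : forall p, I p <->
  [/\ hproj 0 p = 0, hproj 1 p = 0, catalecticant (hproj 2 p) = 0 & f (val (hproj 3 p)) = 0].

Lemma gen_class_ideal p : I p -> gen_class p \in gen_space.
Proof.
by move=> /memI[_ _ p2 p3]; rewrite mem_gen_space p2 eqxx /= -f_twists p3.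
Qed.

Lemma quadric_I (q : H 2) : catalecticant q = 0 -> I (val q).
Proof. by move=> q0; apply/memI; split; rewrite ?hprojK // hproj_ne // linear0. Qed.

Lemma cubic_I (p : H 3) : f (val p) = 0 -> I (val p).
Proof. by move=> p0; apply/memI; split; rewrite ?hprojK // hproj_ne // linear0. Qed.

Lemma gen_class_surj z : z \in gen_space -> exists p, I p /\ gen_class p = z.
Proof.
case: z => q v; rewrite mem_gen_space => /andP[/eqP q0 /eqP v0].
pose p := (twists^-1)%VF v; have pv : twists p = v by rewrite limg_lfunVK // twists_limg memvf.
exists (val q + val p); split.
  by apply: (idealD idealI); [apply: quadric_I | apply: cubic_I; rewrite f_twists pv].
rewrite /gen_class !linearD /= !hprojK (@hproj_ne _ _ 2 3) // (@hproj_ne _ _ 3 2) //.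
by rewrite linear0 addr0 add0r pv.
Qed.

(** The quadric part comes from the linear part of [p], which is zero; the cubic part is a multiple
    of a quadric of [I], which every twist kills. *)
Lemma gen_classXM i p : I p -> gen_class ('X_i * p) = 0.
Proof.
move=> /memI[_ p1 p2 _]; rewrite /gen_class; congr (_, _).
  apply: val_inj; rewrite /= (pihomogM 1 _ (dhomog_is_dhomog (hvar k i))).
  by move/(congr1 val): p1 => /= ->; rewrite mulr0.
have -> : hproj 3 ('X_i * p) = hmul (hvar k i) (hproj 2 p).
  by apply: val_inj; apply: (pihomogM 2 _ (dhomog_is_dhomog (hvar k i))).
apply/rowP => a; rewrite lfunE !mxE.
rewrite (twistM (hvar k i) (hproj 2 p) (basisS_selfadj a)).
exact: (proj1 (catalecticant_eq0 _) p2).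
Qed.

Lemma gen_classM c p : I p -> gen_class (c * p) \in <[gen_class p]>%VS.
Proof.
move=> Ip; rewrite [c]mpolyE mulr_suml linear_sum; apply: memv_suml => m _.
rewrite -scalerAl linearZ /=; apply: memvZ.
have [->|m0] := eqVneq m 0%MM; first by rewrite mpolyX0 mul1r memv_line.
have [i mi] : exists i, m i != 0%N.
  apply/existsP; apply: contra_neqT m0 => /existsPn m0; apply/mnmP => i.
  by rewrite mnm0E; apply/eqP; have := m0 i; rewrite negbK.
have -> : m = (U_(i) + (m - U_(i)))%MM by rewrite addmC submK // lep1mP.
by rewrite mpolyXD -mulrA gen_classXM ?mem0v //; apply: (idealM idealI).
Qed.

Lemma generates_span m (b : 'I_m -> {mpoly k[4]}) (T : {set 'I_m}) :
  (forall i, I (b i)) -> generates I b T -> (gen_space <= \sum_(i in T) <[gen_class (b i)]>)%VS.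
Proof.
move=> Ib gen; apply/subvP => z /gen_class_surj[p [/gen[c ->] <-]].
rewrite linear_sum; apply: memv_sumr => i _.
exact: gen_classM.
Qed.

Lemma catalecticant_delta j : exists q : H 2, forall i, f ('X_i * val q) = (i == j)%:R.
Proof.
have /memv_imgP[q _ E] : delta_mx 0 j \in limg catalecticant.
  by rewrite catalecticant_limg memvf.
exists q => i; have /rowP/(_ i) := E; rewrite lfunE !mxE eqxx /= => <-.
by rewrite eq_sym.
Qed.

Lemma ideal_sum (J : {mpoly k[4]} -> Prop) (A : Type) (r : seq A) (P : pred A)
    (F : A -> {mpoly k[4]}) :
  is_ideal J -> (forall i, P i -> J (F i)) -> J (\sum_(i <- r | P i) F i).
Proof. by move=> [J0 JD _] JF; apply: big_ind. Qed.

Lemma ideal_scale (J : {mpoly k[4]} -> Prop) a p : is_ideal J -> J p -> J (a *: p).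
Proof. by move=> [_ _ JM] Jp; rewrite -mul_mpolyC; apply: JM. Qed.

(** Generation in degrees two and three: the cubics of [I] already yield all quartics, and
    multiplication by variables yields the rest. *)
Lemma apolar_ideal_sub (J : {mpoly k[4]} -> Prop) : is_ideal J ->
  (forall q : H 2, catalecticant q = 0 -> J (val q)) ->
  (forall p : H 3, f (val p) = 0 -> J (val p)) -> forall p, I p -> J p.
Proof.
move=> idJ J2 J3; have [J0 JD JM] := idJ.
have J4 p : p \is 4.-homog -> J p.
  apply: homogS_ind => // a c hc.
  (* Modulo the annihilator every cubic is a multiple of ['X_j * q], and ['X_a * q]
     lies in the annihilator. *)
  pose j : 'I_4 := if a == 0 then 1 else 0.
  have aj : (a == j) = false by rewrite /j; case: (eqVneq a 0) => [->|/negPf].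
  have [q qE] := catalecticant_delta j.
  pose c' : H 3 := DHomog hc - f c *: hmul (hvar k j) q.
  have -> : 'X_a * c = 'X_a * val c' + (f c *: 'X_j) * val (hmul (hvar k a) q).
    by rewrite /c' /= mulrBr -scalerAl -scalerAr [_ * ('X_a * _)]mulrCA subrK.
  apply: JD; apply: JM; apply: J3; last by rewrite /= qE aj.
  by rewrite /c' /= linearB linearZ /= qE eqxx [_ *: _]mulr1 subrr.
have J4n n p : p \is (4 + n).-homog -> J p.
  elim: n p => [|n IHn] p; first exact: J4.
  rewrite addnS; apply: homogS_ind => // i q hq.
  by apply: JM; apply: IHn.
move=> p /memI[p0 p1 p2 p3].
rewrite [p](@pihomog_partitionE _ _ mdeg (mmeasure mdeg p) p) //.
apply: ideal_sum => // -[[|[|[|[|d]]]] _] _ /=.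
- by move/(congr1 val): p0 => /= ->.
- by move/(congr1 val): p1 => /= ->.
- exact: J2 p2.
- exact: J3 p3.
- by apply: (J4n d); apply: pihomogP.
Qed.

(** A graded Nakayama lemma, converse to [generates_span]. By homogeneity the components of each
    generator stay in the ideal [J] they generate; [J] then contains the quadrics of [I], next its
    cubics, and finally all of [I]. *)
Lemma span_generates m (b : 'I_m -> {mpoly k[4]}) (T : {set 'I_m}) :
  (forall i, I (b i)) -> (forall i, exists d, b i \is d.-homog) ->
  (gen_space <= \sum_(i in T) <[gen_class (b i)]>)%VS -> generates I b T.
Proof.
move=> Ib hb sub p.
pose J p := exists c : 'I_m -> {mpoly k[4]}, p = \sum_(i in T) c i * b i.
have idJ : is_ideal J.
  split.
  - by exists (fun=> 0); rewrite big1 // => i _; rewrite mul0r.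
  - move=> _ _ [c ->] [c' ->]; exists (fun i => c i + c' i).
    by rewrite -big_split; apply: eq_bigr => i _; rewrite mulrDl.
  - move=> a _ [c ->]; exists (fun i => a * c i).
    by rewrite mulr_sumr; apply: eq_bigr => i _; rewrite mulrA.
split=> [|[c ->]]; last first.
  by apply: ideal_sum => // i _; apply: (idealM idealI).
have Jb i d : i \in T -> J (val (hproj d (b i))).
  move=> iT; have [e he] := hb i; have [ed|ed] := eqVneq e d.
    exists (fun j => (j == i)%:R); rewrite /= -ed pihomog_dE //.
    rewrite (bigD1 i) //= eqxx mul1r big1 ?addr0 // => j /andP[_ /negPf ->].
    by rewrite mul0r.
  rewrite /= (pihomog_ne0 ed he); exact: (ideal0 idJ).
have comb z : z \in gen_space -> exists c : 'I_m -> k, z = \sum_(i in T) c i *: gen_class (b i).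
  move/(subvP sub)/memv_sumP => [v vT ->].
  have vl i : exists a, i \in T -> v i = a *: gen_class (b i).
    have [iT|_] := boolP (i \in T); last by exists 0.
    by have /vlineP[a ->] := vT i iT; exists a.
  have [c cE] := fin_all_exists vl; exists c.
  by apply: eq_bigr => i /cE.
have J2 (q : H 2) : catalecticant q = 0 -> J (val q).
  move=> q0; have [|c /(congr1 fst) /= qE] := comb (q, 0).
    by rewrite mem_gen_space q0 linear0 !eqxx.
  have -> : q = \sum_(i in T) c i *: hproj 2 (b i).
    by rewrite {1}qE (big_morph fst (fun _ _ => erefl) erefl); apply: eq_bigr.
  rewrite linear_sum; apply: ideal_sum => // i iT.
  by rewrite linearZ; apply: ideal_scale => //; apply: Jb.
have J3 (q : H 3) : f (val q) = 0 -> J (val q).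
  move=> q0; have [|c /(congr1 snd) /= qE] := comb (0, twists q).
    by rewrite mem_gen_space linear0 -f_twists q0 !eqxx.
  (* A cubic of [J] with the same twists as [q]; the difference comes from the quadrics by
     [twists_eq0]. *)
  pose q' := \sum_(i in T) c i *: hproj 3 (b i).
  have qq' : twists (q - q') = 0.
    apply/eqP; rewrite linearB subr_eq0 /= qE (big_morph snd (fun _ _ => erefl) erefl).
    by rewrite /q' linear_sum; apply/eqP/eq_bigr => i _; rewrite [RHS]linearZ.
  rewrite -[q](subrK q'); apply: (idealD idJ).
    apply: (twists_eq0 idJ _ qq') => q2; rewrite memv_ker => /eqP; exact: J2.
  rewrite linear_sum; apply: ideal_sum => // i iT.
  by rewrite linearZ; apply: ideal_scale => //; apply: Jb.
exact: (apolar_ideal_sub idJ J2 J3).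
Qed.

(** The classes of irredundant generators span [gen_space] irredundantly, so they form a basis of
    it. *)
Lemma minimal_generators_dim m (b : 'I_m -> {mpoly k[4]}) :
  minimal_generators I b -> m = \dim gen_space.
Proof.
move=> [hb gen irr].
have Ib i : I (b i).
  apply/gen; exists (fun j => (j == i)%:R).
  rewrite (bigD1 i) ?in_setT //= eqxx mul1r big1 ?addr0 // => j /andP[_ /negPf ->].
  by rewrite mul0r.
apply: (@irredundant_sum_dim _ _ _ (fun i => gen_class (b i))) => [|i sub].
  apply/eqP; rewrite eqEsubv; apply/andP; split.
    by apply/subv_sumP => i _; rewrite -memvE gen_class_ideal.
  have := generates_span Ib gen.
  by rewrite (eq_bigl predT) // => i; rewrite in_setT.
apply: (irr [set~ i]).
  by rewrite properEneq subsetT andbT; apply/eqP => /setP/(_ i); rewrite !inE eqxx.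
apply: span_generates => //; rewrite (eq_bigl (fun j => j != i)) // => j.
by rewrite !inE.
Qed.

(** A basis of the six quadrics, followed by cubics lifting a basis of the kernel of
    [unit_coord]. *)
Lemma minimal_generators_exist :
  exists b : 'I_(\dim S + 5) -> {mpoly k[4]}, minimal_generators I b.
Proof.
pose K := lker (linfun unit_coord).
pose b0 (i : 'I_(6 + \dim K)) : {mpoly k[4]} := match split i with
  | inl j => val (vbasis (lker catalecticant))`_j
  | inr j => val ((twists^-1)%VF (vbasis K)`_j) end.
have eqm : (6 + \dim K)%N = (\dim S + 5)%N.
  transitivity ((\dim K).+1 + 5)%N; first by rewrite addSnnS addnC.
  by congr (_ + 5)%N; apply: dim_ker_unit_coord.
suff : exists b : 'I_(6 + \dim K) -> {mpoly k[4]}, minimal_generators I b.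
  by rewrite eqm.
exists b0.
have Kinv v : v \in K -> twists ((twists^-1)%VF v) = v.
  by move=> _; rewrite limg_lfunVK // twists_limg memvf.
have bK j : (j < \dim K)%N -> (vbasis K)`_j \in K.
  by move=> jK; apply: vbasis_mem; rewrite mem_nth // size_tuple.
have bC (j : 'I_6) : (vbasis (lker catalecticant))`_j \in lker catalecticant.
  by apply: vbasis_mem; rewrite mem_nth // size_tuple catalecticant_dim.
have Ib i : I (b0 i).
  rewrite /b0; case: split => j.
    by apply: quadric_I; apply/eqP; rewrite -memv_ker.
  apply: cubic_I; rewrite f_twists Kinv ?bK //; apply/eqP.
  by rewrite -[unit_coord _]lfunE -memv_ker bK.
have hb i : exists d, b0 i \is d.-homog.
  by rewrite /b0; case: split => j; eexists; apply: dhomog_is_dhomog.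
have b0l j : b0 (lshift _ j) = val (vbasis (lker catalecticant))`_j.
  by rewrite /b0 (unsplitK (inl j)).
have b0r j : b0 (rshift _ j) = val ((twists^-1)%VF (vbasis K)`_j).
  by rewrite /b0 (unsplitK (inr j)).
have gen_class2 (q : H 2) : gen_class (val q) = (q, 0).
  by rewrite /gen_class hprojK hproj_ne // linear0.
have gen_class3 (p : H 3) : gen_class (val p) = (0, twists p).
  by rewrite /gen_class hprojK hproj_ne.
pose W := (\sum_(i in [set: 'I_(6 + \dim K)]) <[gen_class (b0 i)]>)%VS.
have memW i : gen_class (b0 i) \in W by rewrite memvE (sumv_sup i) ?in_setT.
have gen_sub : (gen_space <= W)%VS.
  apply/subvP => -[q v]; rewrite mem_gen_space => /andP[q0 v0].
  have qE : q \in lker catalecticant by rewrite memv_ker.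
  have vE : v \in K by rewrite memv_ker lfunE.
  have -> : (q, v) = (q, 0) + (0, v) by congr (_, _); rewrite ?addr0 ?add0r.
  apply: memvD.
    rewrite -gen_class2 {1}(coord_vbasis qE) !linear_sum; apply: memv_suml => j _.
    rewrite !linearZ; apply: memvZ.
    by rewrite /= -(b0l (cast_ord catalecticant_dim j)) memW.
  have -> : (0, v) = \sum_j coord (vbasis K) j v *: gen_class (b0 (rshift _ j)).
    transitivity (gen_class (val (\sum_j coord (vbasis K) j v *: (twists^-1)%VF (vbasis K)`_j))).
      rewrite gen_class3 linear_sum {1}(coord_vbasis vE); congr (_, _).
      by apply: eq_bigr => j _; rewrite linearZ /= Kinv // bK.
    by rewrite !linear_sum; apply: eq_bigr => j _; rewrite b0r !linearZ.
  by apply: memv_suml => j _; apply: memvZ.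
split=> // [|T Tproper gen]; first exact: span_generates.
(* A generating subset has at least [\dim gen_space] elements, the size of the whole family. *)
have := leq_trans (dimvS (generates_span Ib gen)) (dimv_leq_sum _ _ _).
rewrite dim_gen_space -eqm leqNgt; apply/negP/negPn.
apply: leq_ltn_trans (_ : #|T| < _)%N; last first.
  by rewrite -[X in (_ < X)%N]card_ord -cardsT; apply: proper_card.
by rewrite -sum1_card; apply: leq_sum => i _; rewrite dim_vline; case: (_ != _).
Qed.

Lemma num_minimal_generators_apolar : num_minimal_generators I (\dim S + 5).
Proof.
split; first exact: minimal_generators_exist.
by move=> m' b /minimal_generators_dim ->; rewrite dim_gen_space.
Qed.

End CubicForm.

(** * Graded quotients of the polynomial ring *)

Lemma has_dim_uniq (k : fieldType) (V : lmodType k) (W : V -> Prop) n (b : 'I_n -> V) :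
  is_subspace W -> (forall i, W (b i)) ->
  (forall v, W v -> exists! c : 'rV[k]_n, v = \sum_(i < n) c 0 i *: b i) ->
  forall c c' : 'rV[k]_n, \sum_(i < n) c 0 i *: b i = \sum_(i < n) c' 0 i *: b i -> c = c'.
Proof.
move=> [W0 WD WZ] Wb ex c c' E.
have Wv : W (\sum_(i < n) c 0 i *: b i).
  by apply: (big_ind W) => // i _; apply: WZ.
by have [d [_ duniq]] := ex _ Wv; rewrite -(duniq c) // -(duniq c').
Qed.

Section GradedQuotient.
Variables (k : fieldType) (A : comAlgType k) (Agr : nat -> A -> Prop).
Variable (pi : {lrmorphism {mpoly k[4]} -> A}).
Hypothesis A_grading : is_grading Agr.
Hypothesis pi_graded : forall (d : nat) (p : {mpoly k[4]}),
    p \is d.-homog -> Agr d (pi p).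
Hypothesis pi_surj : forall a : A, exists p : {mpoly k[4]}, pi p = a.

Lemma pi_component d p : pi p = 0 -> pi (pihomog mdeg d p) = 0.
Proof.
move=> p0; pose N := maxn d.+1 (mmeasure mdeg p).
have dN : (d < N)%N by rewrite leq_max leqnn.
apply: (grading_direct A_grading (f := fun i => pi (pihomog mdeg i p)) (n := N)) => // [i|].
  exact/pi_graded/pihomogP.
by rewrite -linear_sum -pihomog_partitionE ?leq_maxr.
Qed.

(** Subtracting [a] in degree [d] from the images of the components of any preimage gives terms with
    sum zero, which vanish by directness. *)
Lemma pi_lift d a : Agr d a -> exists2 p, p \is d.-homog & pi p = a.
Proof.
move=> da; have [p pa] := pi_surj a; exists (pihomog mdeg d p); first exact: pihomogP.
pose N := maxn d.+1 (mmeasure mdeg p).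
have dN : (d < N)%N by rewrite leq_max leqnn.
pose g i := pi (pihomog mdeg i p) - (if i == d then a else 0).
apply: subr0_eq; have := @grading_direct _ _ _ A_grading N g _ _ d dN.
rewrite /g eqxx; apply=> [i|].
  have [s0 sD sZ] := grading_subspace A_grading i.
  apply: sD; first exact/pi_graded/pihomogP.
  rewrite -scaleN1r; apply: sZ; case: eqP => // ->; exact: da.
rewrite sumrB -linear_sum -pihomog_partitionE ?leq_maxr //= pa.
by rewrite -big_mkcond (big_pred1 (Ordinal dN)) ?subrr.
Qed.

Hypothesis socle : forall I : A -> Prop, is_ideal I ->
    (exists x, I x /\ x <> 0) -> forall a, Agr 3 a -> I a.

(** The principal ideal of [a] contains [Agr 3]; comparing components of degree three makes the
    cofactor homogeneous. *)
Lemma socle_factor e a w : (e <= 3)%N -> Agr e a -> a != 0 -> Agr 3 w ->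
  exists2 r, r \is (3 - e).-homog & a * pi r = w.
Proof.
move=> e3 ea a0 hw; have [q hq qa] := pi_lift ea; have [p hp pw] := pi_lift hw.
have [] := socle (I := fun x => exists b, x = a * b) _ _ hw.
- split; first by exists 0; rewrite mulr0.
  + by move=> _ _ [b ->] [c ->]; exists (b + c); rewrite mulrDr.
  + by move=> c _ [b ->]; exists (c * b); rewrite mulrCA.
- by exists a; split; [exists 1; rewrite mulr1 | apply/eqP].
move=> b; have [t <-] := pi_surj b => wE; exists (pihomog mdeg (3 - e) t); first exact: pihomogP.
have qtE : pihomog mdeg 3 (q * t) = q * pihomog mdeg (3 - e) t.
  by have := pihomogM (3 - e) t hq; rewrite subnKC.
have : pi (pihomog mdeg 3 (q * t - p)) = 0.
  by apply: pi_component; rewrite linearB /= rmorphM /= qa -wE pw subrr.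
rewrite linearB /= qtE (pihomog_dE hp) linearB /= rmorphM /= qa pw => /subr0_eq.
by [].
Qed.

Hypothesis top : forall i a, (3 < i)%N -> Agr i a -> a = 0.
Hypothesis dim3 : has_dim (Agr 3) 1.
Hypothesis dim1 : has_dim (Agr 1) 4.

Lemma top_generator : exists w, [/\ Agr 3 w, w != 0 & forall a, Agr 3 a -> exists c, a = c *: w].
Proof.
have [b [hb ex]] := dim3; exists (b 0); split=> //.
  apply/eqP => b0; have := has_dim_uniq (grading_subspace A_grading 3) hb ex.
  move/(_ 0 (delta_mx 0 0)); rewrite !big_ord1 b0 !scaler0 => /(_ erefl)/rowP/(_ 0).
  by rewrite !mxE eqxx => /eqP; rewrite eq_sym oner_eq0.
by move=> a /ex[c [-> _]]; exists (c 0 0); rewrite big_ord1.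
Qed.

Lemma dual_form w : Agr 3 w -> (forall a, Agr 3 a -> exists c, a = c *: w) ->
  exists f : {linear {mpoly k[4]} -> k^o}, forall p, p \is 3.-homog -> pi p = f p *: w.
Proof.
move=> w3 span.
(* Restricting to the finite type of monomials of degree below four allows all coefficients to be
   chosen at once. *)
have cE (m : 'X_{1..4 < 4}) : exists c, mdeg m = 3%N -> pi 'X_[m] = c *: w.
  have [dm|] := eqVneq (mdeg m) 3; last by move=> /eqP dm; exists 0.
  have [|c cw] := span (pi 'X_[m]); last by exists c.
  by apply: pi_graded; rewrite dhomogX; apply/eqP.
have [c {}cE] := fin_all_exists cE.
pose c' m := oapp c 0 (insub m).
exists (cubic_functional c') => p /dhomogP hp.
rewrite {1}[p]mpolyE [in RHS](mpolyE p) !linear_sum scaler_suml.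
apply: eq_big_seq => m /hp /= dm; rewrite !linearZ /= cubic_functionalX //.
have lt4 : (mdeg m < 4)%N by rewrite dm.
by rewrite -scalerA /c' insubT /= -cE.
Qed.

Lemma pi_linear_form (x : dhomog 4 k 1) : pi (val x) = \sum_i (val x)@_U_(i) *: pi 'X_i.
Proof.
rewrite {1}(linear_formE x) !linear_sum; apply: eq_bigr => i _.
by rewrite !linearZ.
Qed.

(** Lifting a basis of [Agr 1] gives a one-sided inverse of the matrix of [pi] in degree one; both
    spaces have dimension four, so it is two-sided. *)
Lemma pi_inj1 (x : dhomog 4 k 1) : pi (val x) = 0 -> x = 0.
Proof.
have [b [hb ex]] := dim1.
have uniq := has_dim_uniq (grading_subspace A_grading 1) hb ex.
have lift j : exists y : dhomog 4 k 1, pi (val y) = b j.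
  by have [p hp pE] := pi_lift (hb j); exists (DHomog hp).
have [y yE] := fin_all_exists lift.
have coords i : exists c : 'rV[k]_4, pi 'X_i = \sum_j c 0 j *: b j.
  have [|c [-> _]] := ex (pi 'X_i); last by exists c.
  by apply: pi_graded; rewrite dhomogX; apply/eqP/mdeg1.
have [c {}cE] := fin_all_exists coords.
pose M := \matrix_i c i; pose N := \matrix_(j, i) (val (y j))@_U_(i).
have NM : N *m M = 1%:M.
  apply/row_matrixP => j; apply: uniq; rewrite row1.
  transitivity (b j); last first.
    rewrite (bigD1 j) //= big1 ?addr0 => [|i ij]; rewrite !mxE eqxx ?eqxx ?scale1r //=.
    by rewrite (negPf ij) scale0r.
  rewrite -yE pi_linear_form.
  transitivity (\sum_i \sum_l (N j i * M i l) *: b l).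
    rewrite exchange_big; apply: eq_bigr => l _; rewrite -scaler_suml; congr (_ *: _).
    by rewrite !mxE.
  apply: eq_bigr => i _; rewrite cE scaler_sumr; apply: eq_bigr => l _.
  by rewrite !mxE scalerA.
move=> x0; pose a := \row_i (val x)@_U_(i).
have aM : a *m M = 0.
  apply: uniq; transitivity (pi (val x)); last first.
    by rewrite x0 big1 // => i _; rewrite mxE scale0r.
  rewrite pi_linear_form.
  transitivity (\sum_i \sum_l (a 0 i * M i l) *: b l).
    rewrite exchange_big; apply: eq_bigr => l _; rewrite -scaler_suml; congr (_ *: _).
    by rewrite !mxE.
  apply: eq_bigr => i _; rewrite cE scaler_sumr; apply: eq_bigr => l _.
  by rewrite !mxE scalerA.
have a0 : a = 0 by rewrite -[a]mulmx1 -(mulmx1C NM) mulmxA aM mul0mx.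
rewrite (linear_formE x) big1 // => i _; move/rowP/(_ i): a0; rewrite !mxE => ->.
by rewrite scale0r.
Qed.

Section DualForm.
Variables (w : A) (f : {linear {mpoly k[4]} -> k^o}).
Hypotheses (w3 : Agr 3 w) (w0 : w != 0).
Hypothesis fE : forall p, p \is 3.-homog -> pi p = f p *: w.

Lemma dual_form_eq0 p : p \is 3.-homog -> pi p = 0 <-> f p = 0.
Proof.
move=> hp; rewrite fE //; split=> [/eqP|->]; last by rewrite scale0r.
by rewrite scaler_eq0 (negPf w0) orbF => /eqP.
Qed.

(** If [pi x] were nonzero, some quadric [r] would have [pi (x * r) = w], but [r] is a sum of
    products of linear forms. *)
Lemma dual_form_nondeg (x : dhomog 4 k 1) :
  (forall y z : dhomog 4 k 1, f (val x * val y * val z) = 0) -> x = 0.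
Proof.
move=> x0; apply: pi_inj1; apply/eqP; apply: contraT => pix0.
have [//|r hr rE] := @socle_factor 1 _ w _ (pi_graded (dhomog_is_dhomog x)) pix0 w3.
suff : f (val x * r) = 0.
  move/(dual_form_eq0 (dhomogM (dhomog_is_dhomog x) hr)).
  by rewrite rmorphM /= rE => /eqP; rewrite (negPf w0).
apply: (@homogS_ind _ _ 1 (fun r => f (val x * r) = 0)) hr.
- by rewrite mulr0 linear0.
- by move=> p q hp hq; rewrite mulrDr linearD /= hp hq addr0.
by move=> i q hq; have := x0 (hvar k i) (DHomog hq); rewrite -mulrA.
Qed.

(** The kernel is homogeneous, so degrees separate: [pi] is injective in degrees zero and one,
    degree two pairs with degree one by [socle_factor], [f] decides degree three, and the algebra is
    zero beyond. *)
Lemma pi_eq0P p : pi p = 0 <->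
  [/\ hproj 0 p = 0, hproj 1 p = 0, catalecticant f (hproj 2 p) = 0 & f (val (hproj 3 p)) = 0].
Proof.
split=> [p0|[p0 p1 p2 p3]].
  have pd d : pi (pihomog mdeg d p) = 0 by apply: pi_component.
  split.
  - apply: val_inj => /=; have := pd 0%N.
    rewrite (dhomog0_const (pihomogP mdeg 0 p)) -alg_mpolyC linearZ /= rmorph1.
    by move=> /eqP; rewrite scaler_eq0 oner_eq0 orbF => /eqP ->; rewrite scale0r.
  - by apply: pi_inj1; apply: pd.
  - apply/catalecticant_eq0 => x; apply/dual_form_eq0.
      exact: (dhomogM (dhomog_is_dhomog x) (dhomog_is_dhomog (hproj 2 p))).
    by rewrite rmorphM /= pd mulr0.
  - exact: (proj1 (dual_form_eq0 (pihomogP mdeg 3 p)) (pd 3%N)).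
rewrite [p](@pihomog_partitionE _ _ mdeg (mmeasure mdeg p) p) // linear_sum.
apply: big1 => -[d hd] _ /=; case: d hd => [|[|[|[|d]]]] hd.
- by move/(congr1 val): p0 => /= ->; rewrite linear0.
- by move/(congr1 val): p1 => /= ->; rewrite linear0.
- apply/eqP; apply: contraT => q0.
  have [//|r hr rE] := @socle_factor 2 _ w _ (pi_graded (pihomogP mdeg 2 p)) q0 w3.
  case/eqP: w0; rewrite -rE -rmorphM; apply/dual_form_eq0.
    by apply: (dhomogM (pihomogP mdeg 2 p) hr).
  by rewrite mulrC; apply: (proj1 (catalecticant_eq0 _ _) p2 (DHomog hr)).
- exact: (proj2 (dual_form_eq0 (pihomogP mdeg 3 p)) p3).
by apply: (@top d.+4) => //; apply/pi_graded/pihomogP.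
Qed.

End DualForm.

End GradedQuotient.

Theorem corollary1p1 (k : fieldType) (A : comAlgType k)
  (Agr : nat -> A -> Prop)
  (A_gorenstein : artinian_gorenstein Agr 3)
  (A_embdim : has_dim (Agr 1%N) 4)
  (pi : {lrmorphism {mpoly k[4]} -> A})
  (pi_graded : forall (d : nat) (p : {mpoly k[4]}),
    p \is d.-homog -> Agr d (pi p))
  (pi_surj : forall a : A, exists p : {mpoly k[4]}, pi p = a) :
  exists m : nat,
    num_minimal_generators (fun p : {mpoly k[4]} => pi p = 0) m /\
    [\/ m = 6%N, m = 7%N | m = 9%N].
Proof.
have [[gr _ _] _ top dim3 socle] := A_gorenstein.
have [w [w3 w0 span]] := top_generator gr dim3.
have [f fE] := dual_form pi_graded w3 span.
have f_nondeg := dual_form_nondeg gr pi_graded pi_surj socle A_embdim w3 w0 fE.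
have memI := pi_eq0P gr pi_graded pi_surj socle top A_embdim w3 w0 fE.
have idealI : is_ideal (fun p : {mpoly k[4]} => pi p = 0).
  split=> [|p q p0 q0|q p p0]; first exact: linear0.
    by rewrite linearD /= p0 q0 addr0.
  by rewrite rmorphM /= p0 mulr0.
have [S memS] : exists S : {vspace 'End(dhomog 4 k 1)},
    forall s, s \in S <-> selfadj (cubic_phi f) s.
  apply: vspace_of_pred => [x y z|a s t hs ht x y z].
    by rewrite !zero_lfunE /cubic_phi !mul0r mulr0 mul0r.
  rewrite !add_lfunE !scale_lfunE cubic_phi_linear hs ht.
  by rewrite [RHS]cubic_phiC12 cubic_phi_linear !(cubic_phiC12 _ x).
(* Six quadrics and [\dim S - 1] cubics. *)
exists (\dim S + 5)%N; split; first exact: (num_minimal_generators_apolar f_nondeg memS).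
have := selfadj_dim (@cubic_phi_linear k f) (@cubic_phiC12 k f) (@cubic_phiC23 k f)
  f_nondeg memS (@dim_H1 k).
by case=> ->; [apply: Or31 | apply: Or32 | apply: Or33].
Qed.
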